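(* Let $d \ge 3$ be an integer and let $\varepsilon > 0$ be an arbitrarily small constant. Then asymptotically almost surely (as $n \to \infty$) $$ q^*(\mathcal{G}_{n,d}) \le U_3(d) + \frac{\varepsilon}{d}, \qquad \text{where}\quad U_3(d) := \sup_{x \in (0,1)} \left( \frac{\bar y(x,d)}{d} - x \right), $$ and $\bar y(x,d)$ is the largest value of $y \in (0,d)$ such that $f(x,y,d) = 0$, with $f$ the function \begin{align*} f(x,y,d) :={}& x(y/2-1) \log x + (1-x)(d-1)\log(1-x) + \tfrac{1}{2} d \log d \\ & - \tfrac{1}{2} xy \log y - x(d-y) \log(d-y) - \tfrac{1}{2}(d-2xd+xy) \log (d-2xd+xy). \end{align*}
   Context: Modularity: for a graph $G$ with at least one edge and a partition $\mathcal{A} = \{A_1,\dots,A_k\}$ of $V(G)$, $$q_{\mathcal{A}}(G) = \sum_{A \in \mathcal{A}} \left( \frac{e(A)}{|E(G)|} - \frac{(\sum_{v\in A}\deg(v))^2}{4|E(G)|^2}\right),$$ where $e(A) = |\{uv \in E(G): u,v\in A\}|$ is the number of edges inside $A$. The modularity of $G$ is $q^*(G) = \max_{\mathcal{A}} q_{\mathcal{A}}(G)$, the maximum over all partitions $\mathcal{A}$ of $V(G)$. $\mathcal{G}_{n,d}$ denotes the uniformly random (simple) $d$-regular graph on $n$ labelled vertices; asymptotics are for $n\to\infty$ with $d$ fixed, and $n$ even if $d$ is odd. An event holds asymptotically almost surely (a.a.s.) if its probability tends to $1$ as $n\to\infty$. Logarithms are natural. For fixed $x\in(0,1)$, $f(x,y,d)$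 is considered for those $y\in(0,d)$ for which it is defined, i.e. $d-2xd+xy \ge 0$, with the convention $0\log 0=0$. For $x \in (0,1)$ the limit of $f(x,y,d)$ as $y\to d$ is negative and $f(x,xd,d)>0$, so $\bar y(x,d)$ exists and $f(x,y,d)<0$ for all $y \in (\bar y(x,d), d)$. *)

(* Defs.v *)
From mathcomp Require Import all_boot all_order all_algebra.
From mathcomp Require Import all_classical all_reals all_analysis.

Set Implicit Arguments.
Unset Strict Implicit.
Unset Printing Implicit Defensive.

Import Order.TTheory GRing.Theory Num.Theory.
Import numFieldNormedType.Exports.

Local Open Scope classical_set_scope.
Local Open Scope ring_scope.

(* A simple graph on the vertex set T is given by its edge set
   E : {set {set T}}, all of whose members are two-element sets. *)
Section Graphs.
Variable T : finType.
Implicit Types (E : {set {set T}}) (A : {set T}).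

Definition simple_graph E : bool := [forall e in E, #|e| == 2%N].

Definition degree E (v : T) : nat := #|[set e in E | v \in e]|.

Definition edges_inside E A : nat := #|[set e in E | e \subset A]|.

Definition regular_graph (d : nat) E : bool :=
  simple_graph E && [forall v, degree E v == d].

End Graphs.

Section Modularity.
Variables (R : realType) (T : finType).
Implicit Types (E : {set {set T}}) (P : {set {set T}}).

(* Only meaningful when E is nonempty; otherwise the value is 0, since
   division by zero yields 0. *)
Definition partition_modularity E P : R :=
  \sum_(A : {set T} | A \in P) ((edges_inside E A)%:R / #|E|%:R
    - (\sum_(v : T | v \in A) degree E v)%N%:R ^+ 2 / (4%:R * #|E|%:R ^+ 2)).

Definition singleton_blocks : {set {set T}} := [set [set v] | v : T]%SET.

(* The default value of the iterated maximum is the score of the partition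
   into singletons, hence does not affect the maximum. *)
Definition modularity E : R :=
  \big[Num.max/partition_modularity E singleton_blocks]_(P : {set {set T}}
      | finset.partition P [set: T]%SET) partition_modularity E P.

Lemma partition_singletons : finset.partition singleton_blocks [set: T]%SET.
Proof.
apply/and3P; split.
- apply/eqP/finset.setP => v; rewrite inE; apply/finset.bigcupP.
  by exists [set v]%SET; rewrite ?inE //; apply/imsetP; exists v.
- apply/finset.trivIsetP => _ _ /imsetP[u _ ->] /imsetP[v _ ->] uv.
  by rewrite disjoints1 inE; apply: contra uv => /eqP ->.
- by apply/imsetP => -[v _ /finset.setP/(_ v)]; rewrite !inE eqxx.
Qed.

Lemma modularity_ge E P : finset.partition P [set: T]%SET ->
  partition_modularity E P <= modularity E.
Proof. by move=> HP; apply: le_bigmax_cond. Qed.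

Lemma modularity_attained E :
  exists2 P, finset.partition P [set: T]%SET &
    modularity E = partition_modularity E P.
Proof.
rewrite /modularity; elim/big_ind: _ => [|x y Hx Hy|P HP].
- by exists singleton_blocks => //; exact: partition_singletons.
- by rewrite /Num.max; case: ifP.
- by exists P.
Qed.

End Modularity.

Section RandomRegularGraphs.
Variable R : realType.

Definition counting_prob (T : finType) (S : {set T}) (Q : pred T) : R :=
  #|[set x in S | Q x]%SET|%:R / #|S|%:R.

Definition regular_graphs (n d : nat) : {set {set {set 'I_n}}} :=
  [set E : {set {set 'I_n}} | regular_graph d E]%SET.

(* The filter n -> oo, restricted to even n when d is odd. *)
Definition admissible_oo (d : nat) : set_system nat :=
  within [set n | odd d -> ~~ odd n] \oo.

Definition aas_regular (d : nat) (Q : forall n, pred {set {set 'I_n}}) : Prop :=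
  counting_prob (regular_graphs n d) (@Q n) @[n --> admissible_oo d] --> (1 : R).

End RandomRegularGraphs.

Section Bound.
Variable R : realType.
Implicit Types x y d : R.

(* The convention 0 log 0 = 0 holds since every logarithm is multiplied by
   its argument wherever that argument may vanish. *)
Definition f x y d : R :=
  x * (y / 2 - 1) * ln x + (1 - x) * (d - 1) * ln (1 - x) + 1 / 2 * d * ln d
  - 1 / 2 * x * y * ln y - x * (d - y) * ln (d - y)
  - 1 / 2 * (d - 2 * x * d + x * y) * ln (d - 2 * x * d + x * y).

Definition zeros_f x d : set R :=
  [set y | [/\ 0 < y < d, 0 <= d - 2 * x * d + x * y & f x y d = 0]].

(* The greatest element of zeros_f x d; the default 0 is never used, as this
   element exists whenever 0 < x < 1 and 2 < d. *)
Definition ybar x d : R := xget 0 (zeros_f x d `&` ubound (zeros_f x d)).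

Definition U3 d : R := sup [set ybar x d / d - x | x in [set x | 0 < x < 1]].

End Bound.

(* Main.v *)
Require Import Defs.
From mathcomp Require Import all_boot all_order all_algebra.
From mathcomp Require Import zify ring lra.
From mathcomp Require Import reals.

(** The proof is a first-moment argument over vertex sets of linear size.

    Let G be d-regular on n vertices, with M = dn/2 edges.  A block with xn
    vertices and inner average degree y contributes x(y/d - x) to the modularity,
    so the modularity is at most beta once y/d - x <= beta for every set.  Sets with
    fewer than delta n vertices may be exempted at a cost of 3 delta: small blocks
    can be merged greedily into sets of size between delta n and 2 delta n, which
    loses no inner edge, and what is left unmerged holds few edges
    ([modularity_le]).  For sets of linear size all probabilities are exponentially
    small, hence factors polynomial in n are harmless in all counts.

    To count graphs, give E the weight prod_v d(d-1)...(d - deg v + 1), the number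
    of ways to attach the edge ends at each vertex to d labelled half-edges.  A
    d-regular graph has weight (d!)^n, and a new edge uv multiplies the weight by
    (d - deg u)(d - deg v).  Double counting the pairs (graph, edge of it) then
    relates the total weights of consecutive sizes ([weight_sum_add]).
    - From above, this yields the count of the pairing model for the graphs with
      prescribed numbers of edges inside S, inside its complement and across
      ([weight_sum_split]).
    - From below, excluding loops and repeated edges spoils at most d(d+1) of the
      choices for each half-edge, so that the total weight stays of order 2^M M! up
      to polynomial factors until d(d+1) half-edges remain free
      ([weight_sum_size]).  The graphs obtained lack boundedly many edges, and
      boundedly many edge replacements turn each of them into a d-regular graph
      ([card_subregular]); so there are at least n^(-O(1)) 2^M M! / (d!)^n
      d-regular graphs.

    Replacing factorials by (z/e)^z, the ratio of the two counts, times the number of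
    sets S, is n^O(1) exp(n f(x,y,d)) ([card_regular_with_inside]).  Finally f is
    negative wherever y exceeds its largest zero, in particular wherever
    y/d - x > U3(d), and it is continuous; so it is at most some -eta < 0 on the
    compact region delta <= x, y/d - x >= U3(d) + e ([f_uniformly_lt0]).  A union
    bound over the sizes of S and the numbers of inner edges finishes the proof. *)

Set Implicit Arguments.
Unset Strict Implicit.
Unset Printing Implicit Defensive.

Import Order.TTheory GRing.Theory Num.Theory.

(** * Weighted graphs and sums over pairs of vertices *)

Section Weights.
Variables (T : finType) (d : nat).
Implicit Types (E : {set {set T}}) (e S : {set T}) (u v : T).

Definition pairs : {set {set T}} := [set e : {set T} | #|e| == 2].

(** The number of ways to attach the edge ends at each vertex to distinct members
    of a set of d half-edges; it vanishes as soon as some degree exceeds d. *)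
Definition degree_weight E := \prod_(v : T) d ^_ (degree E v).

(** The number of half-edges still free at v. *)
Definition room E v := d - degree E v.

Lemma simple_graphE E : simple_graph E = (E \subset pairs).
Proof.
apply/forall_inP/subsetP => [H e /H|H e /H]; by rewrite inE.
Qed.

Lemma degree_add E e v : e \notin E -> degree (e |: E) v = degree E v + (v \in e).
Proof.
move=> eE; rewrite /degree addnC; case: (boolP (v \in e)) => ve.
  have -> : [set x in e |: E | v \in x] = e |: [set x in E | v \in x].
    by apply/setP => x; rewrite !inE; case: eqP => // ->; rewrite ve.
  by rewrite cardsU1 !inE (negPf eE).
rewrite add0n; congr #|pred_of_set _|; apply/setP => x; rewrite !inE.
by case: eqP => [->|//]; rewrite (negPf ve) ?andbF.
Qed.

Lemma weight_add E e : e \notin E ->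
  degree_weight (e |: E) = degree_weight E * \prod_(v in e) room E v.
Proof.
move=> eE; rewrite /degree_weight (bigID (mem e)) /= [in RHS](bigID (mem e)) /=.
rewrite mulnAC -big_split /=; congr (_ * _).
  by apply: eq_bigr => v ve; rewrite degree_add// ve addn1 ffactnSr.
by apply: eq_bigr => v ve; rewrite degree_add// (negPf ve) addn0.
Qed.

Lemma weight_gt0 E v : 0 < degree_weight E -> degree E v <= d.
Proof.
rewrite /degree_weight (bigD1 v)//= muln_gt0 => /andP[+ _].
by rewrite ffact_gt0.
Qed.

Lemma weight_le E : degree_weight E <= d`! ^ #|T|.
Proof.
rewrite /degree_weight -prod_nat_const; apply: leq_prod => v _.
have [dv|dv] := leqP (degree E v) d; last by rewrite ffact_small.
by rewrite -(ffact_fact dv) leq_pmulr// fact_gt0.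
Qed.

Lemma weight_regular E : regular_graph d E -> degree_weight E = d`! ^ #|T|.
Proof.
case/andP=> _ /forallP H; rewrite /degree_weight -prod_nat_const.
by apply: eq_bigr => v _; rewrite (eqP (H v)) ffactnn.
Qed.

Lemma sum_degree E S : \sum_(v in S) degree E v = \sum_(e in E) #|e :&: S|.
Proof.
under eq_bigr do rewrite /degree -sum1_card big_mkcond /=.
rewrite exchange_big /= [RHS]big_mkcond /=; apply: eq_bigr => e _.
case: (boolP (e \in E)) => eE; last first.
  by rewrite big1// => v _; rewrite inE (negPf eE).
rewrite -sum1_card big_mkcond [RHS]big_mkcond /=; apply: eq_bigr => v _.
by rewrite !inE eE /= andbC; case: (v \in S).
Qed.

(** Double counting of the pairs made of a graph and one of its edges in X:
    removing the edge is inverse to adding it. *)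
Lemma sum_add_edge (P Q : pred {set {set T}}) (X : {set {set T}})
    (F : {set {set T}} -> nat) :
  (forall E e, e \in X -> e \notin E -> Q (e |: E) = P E) ->
  \sum_(E | Q E) #|E :&: X| * F E = \sum_(E | P E) \sum_(e in X :\: E) F (e |: E).
Proof.
move=> PQ.
under eq_bigr do rewrite -sum_nat_const.
rewrite (exchange_big_dep (mem X)) /=; last by move=> E e _; rewrite inE => /andP[].
rewrite [RHS](exchange_big_dep (mem X)) /=; last by move=> E e _; rewrite inE => /andP[].
apply: eq_bigr => e eX.
rewrite (reindex_onto (fun E => e |: E) (fun E => E :\ e)) /=; last first.
  by move=> E; rewrite !inE => /andP[_ /andP[eE _]]; rewrite setD1K.
apply: eq_bigl => E; rewrite !inE eqxx eX /= andbT.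
case: (boolP (e \in E)) => eE /=; last by rewrite setU1K// eqxx !andbT PQ.
rewrite !andbF; apply/negP => /andP[_ /eqP] H.
by move: eE; rewrite -H !inE eqxx.
Qed.

Lemma sum_pairs (G : {set T} -> nat) :
  (\sum_(e in pairs) G e) * 2 = \sum_u \sum_(v | v != u) G [set u; v].
Proof.
rewrite big_distrl /=.
transitivity (\sum_(e in pairs) \sum_(u in e) G e).
  by apply: eq_bigr => e; rewrite inE sum_nat_const mulnC => /eqP ->.
rewrite (exchange_big_dep predT)//=; apply: eq_bigr => u _.
have -> : \sum_(v | v != u) G [set u; v] = \sum_(v in [set v | v != u]) G [set u; v].
  by apply: eq_bigl => v; rewrite inE.
rewrite -(@big_imset _ _ addn _ _ (fun v => [set u; v]) [set v | v != u] G) /=;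
  last first.
  move=> v w; rewrite !inE => vu wu /setP/(_ v); rewrite !inE eqxx orbT (negPf vu) /=.
  by move=> /esym/eqP.
apply: eq_bigl => e; rewrite inE; apply/andP/imsetP => [[/cards2P[x [y [xy ->]]]]|[v]].
  rewrite !inE => /orP[] /eqP ->; first by exists y; rewrite // inE eq_sym.
  by exists x; rewrite ?inE// setUC.
by rewrite inE => vu ->; rewrite cards2 (eq_sym u) vu !inE eqxx.
Qed.

Lemma prod_pair (h : T -> nat) u v : v != u -> \prod_(w in [set u; v]) h w = h u * h v.
Proof. by move=> vu; rewrite big_setU1 ?big_set1 //= inE eq_sym. Qed.

Definition pairs_in S : {set {set T}} := [set e in pairs | e \subset S].
Definition pairs_across S : {set {set T}} := [set e in pairs | #|e :&: S| == 1].

(** Expanding the square of the sum of h over S, each pair occurs twice, and the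
    diagonal terms h(v)^2 dominate h(v). *)
Lemma sum_pairs_in (h : T -> nat) S :
  (\sum_(e in pairs_in S) \prod_(v in e) h v) * 2
    <= (\sum_(v in S) h v) * (\sum_(v in S) h v).-1.
Proof.
rewrite big_mkcond /=.
have -> : \sum_i (if i \in pairs_in S then \prod_(v in i) h v else 0) =
          \sum_(e in pairs) (if e \subset S then \prod_(v in e) h v else 0).
  by rewrite [RHS]big_mkcond /=; apply: eq_bigr => e _; rewrite inE; case: (e \in pairs).
rewrite sum_pairs big_distrl [leqRHS]big_mkcond /=; apply: leq_sum => u _.
case: ifPn => uS; last first.
  by rewrite big1// => v _; rewrite subUset sub1set (negPf uS).
have HE : \sum_(v in S) h v = h u + \sum_(v in S | v != u) h v by rewrite (bigD1 u).
have [hu|hu] := posnP (h u).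
  by rewrite big1// => v vu; case: ifP => // _; rewrite prod_pair// hu.
apply: (@leq_trans (h u * \sum_(v in S | v != u) h v)); last first.
  by rewrite leq_mul2l; apply/orP; right; lia.
rewrite big_distrr /= [leqRHS]big_mkcond [leqLHS]big_mkcond /=; apply: leq_sum => v _.
rewrite andbC; case: (boolP (v != u)) => //= vu.
by rewrite subUset !sub1set uS /=; case: (v \in S) => //; rewrite prod_pair.
Qed.

Lemma pairs_acrossE S u v : v != u ->
  ([set u; v] \in pairs_across S) = (u \in S) (+) (v \in S).
Proof.
move=> vu; rewrite !inE cards2 (eq_sym u) vu /=.
have -> : #|[set u; v] :&: S| = (u \in S) + (v \in S).
  transitivity (\sum_(w in [set u; v]) (w \in S : nat)).
    rewrite -sum1_card [LHS]big_mkcond [RHS]big_mkcond; apply: eq_bigr => w _.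
    by rewrite in_setI; case: (w \in [set u; v]); case: (w \in S).
  by rewrite big_setU1 ?big_set1 ?inE 1?(eq_sym u).
by case: (u \in S); case: (v \in S).
Qed.

Lemma sum_pairs_across (h : T -> nat) S :
  \sum_(e in pairs_across S) \prod_(v in e) h v
    = (\sum_(v in S) h v) * (\sum_(v in ~: S) h v).
Proof.
apply/eqP; rewrite -(eqn_pmul2r (isT : 0 < 2)) big_mkcond /=; apply/eqP.
have -> : \sum_i (if i \in pairs_across S then \prod_(v in i) h v else 0) =
          \sum_(e in pairs) (if e \in pairs_across S then \prod_(v in e) h v else 0).
  rewrite [RHS]big_mkcond /=; apply: eq_bigr => e _.
  rewrite [in LHS]inE; case: (boolP (e \in pairs)) => //= eP; by rewrite [in RHS]inE eP.
rewrite sum_pairs.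
transitivity (\sum_u ((if u \in S then h u * \sum_(v in ~: S) h v else 0)
   + (if u \in ~: S then h u * \sum_(v in S) h v else 0))).
  apply: eq_bigr => u _.
  transitivity (\sum_(v | v != u) if (u \in S) (+) (v \in S) then h u * h v else 0).
    by apply: eq_bigr => v vu; rewrite pairs_acrossE// prod_pair.
  rewrite inE; case: ifP => uS /=; rewrite ?addn0 ?add0n big_distrr /= [LHS]big_mkcond
    [RHS]big_mkcond /=; apply: eq_bigr => v _; rewrite ?inE; case: eqP => [->|] //=; rewrite ?uS//.
rewrite big_split /= -!big_mkcond /= -!big_distrl /=; lia.
Qed.

End Weights.

(** * Counting graphs from above by the number of edges inside a set *)

Section UpperCount.
Variables (T : finType) (d : nat).
Implicit Types (E : {set {set T}}) (e S : {set T}) (u v : T).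
Local Notation weight := (@degree_weight T d).
Local Notation room := (@room T d).

Definition split_type S (a b c : nat) E :=
  [&& simple_graph E, #|E :&: pairs_in S| == a, #|E :&: pairs_in (~: S)| == b
    & #|E :&: pairs_across S| == c].

Definition weight_sum (P : pred {set {set T}}) := \sum_(E | P E) weight E.

Lemma pairs_acrossC S : pairs_across (~: S) = pairs_across S.
Proof.
apply/setP => e; rewrite !inE; case: eqP => //= e2.
by have := cardsID S e; rewrite -setDE e2; lia.
Qed.

Lemma pairs_in_sub e S : e \in pairs_in S -> e \in pairs_in (~: S) = false.
Proof.
rewrite !inE => /andP[/eqP e2 eS]; rewrite e2 /=; apply/negP => eC.
have : e \subset set0 by rewrite -(setICr S) subsetI eS.
by rewrite subset0 => /eqP e0; rewrite e0 cards0 in e2.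
Qed.

Lemma pairs_in_across e S : e \in pairs_in S -> e \in pairs_across S = false.
Proof. by rewrite !inE => /andP[/eqP e2 /setIidPl ->]; rewrite e2. Qed.

Lemma pairs_cover e S : e \in pairs T ->
  [|| e \in pairs_in S, e \in pairs_in (~: S) | e \in pairs_across S].
Proof.
rewrite !inE => e2; rewrite e2 /=.
have := cardsID S e; rewrite (eqP e2) => H.
have [h|h|h] := ltngtP #|e :&: S| 1; rewrite ?h ?orbT//.
- have h0 : #|e :&: S| = 0 by lia.
  suff -> : e \subset ~: S by rewrite orbT.
  by rewrite -disjoints_subset -setI_eq0 -cards_eq0 h0.
- have h0 : #|e :\: S| = 0 by lia.
  by suff -> : e \subset S by []; rewrite -setD_eq0 -cards_eq0 h0.
Qed.

Lemma pairs_in_pairs S e : e \in pairs_in S -> e \in pairs T.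
Proof. by rewrite inE => /andP[]. Qed.
Lemma pairs_across_pairs S e : e \in pairs_across S -> e \in pairs T.
Proof. by rewrite inE => /andP[]. Qed.

Lemma card_addI E (X : {set {set T}}) e : e \notin E ->
  #|(e |: E) :&: X| = #|E :&: X| + (e \in X).
Proof.
move=> eE; rewrite setIUl; case: (boolP (e \in X)) => eX.
  by rewrite (setIidPl _) ?sub1set// cardsU1 inE (negPf eE) addnC.
rewrite (_ : [set e] :&: X = set0) ?set0U ?addn0//.
by apply/setP => x; rewrite !inE; case: eqP => // ->; rewrite (negPf eX).
Qed.

Lemma simple_add E e : e \in pairs T -> simple_graph (e |: E) = simple_graph E.
Proof. by move=> eP; rewrite !simple_graphE subUset sub1set eP. Qed.

(** Edges inside S have two ends in S, edges across have one. *)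
Lemma split_type_sum_degree S a b c E : split_type S a b c E ->
  \sum_(v in S) degree E v = 2 * a + c.
Proof.
case/and4P=> sE /eqP <- _ /eqP <-.
rewrite sum_degree -!sum1_card big_distrr /=.
rewrite big_mkcond [in RHS]big_mkcond [X in _ = _ + X]big_mkcond -big_split /=.
apply: eq_bigr => e _; rewrite !in_setI.
case: (boolP (e \in E)) => //= eE.
move: sE; rewrite simple_graphE => /subsetP/(_ e eE) eP.
case: (boolP (e \in pairs_in S)) => [h|h1].
  rewrite (pairs_in_across h); move: h; rewrite !inE => /andP[/eqP e2 /setIidPl ->]; lia.
case: (boolP (e \in pairs_across S)) => [|h2]; first by rewrite !inE => /andP[_ /eqP ->].
have := pairs_cover S eP; rewrite (negPf h1) (negPf h2) orbF /= inE => /andP[_].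
by rewrite -disjoints_subset -setI_eq0 => /eqP ->; rewrite cards0.
Qed.

Lemma split_typeC S a b c E : split_type (~: S) b a c E = split_type S a b c E.
Proof. by rewrite /split_type setCK pairs_acrossC; congr (_ && _); rewrite andbCA. Qed.

Lemma sum_room S m E : 0 < weight E ->
  \sum_(v in S) degree E v = m -> \sum_(v in S) room E v = d * #|S| - m.
Proof.
move=> w0 <-; apply/eqP; rewrite -(eqn_add2r (\sum_(v in S) degree E v)) -big_split /=.
rewrite (eq_bigr (fun=> d)) => [|v _]; last by rewrite /room subnK// (weight_gt0 _ w0).
rewrite sum_nat_const mulnC subnK// [leqRHS]mulnC -sum_nat_const.
by apply: leq_sum => v _; exact: weight_gt0 w0.
Qed.

(** The recursion behind all the counts.  When the graphs in Q are those in P with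
    one more edge from X, a graph in Q arises m times, once for each of its edges
    in X. *)
Lemma weight_sum_add (P Q : pred {set {set T}}) (X : {set {set T}}) m :
  (forall E e, e \in X -> e \notin E -> Q (e |: E) = P E) ->
  (forall E, Q E -> #|E :&: X| = m) ->
  m * weight_sum Q =
    \sum_(E | P E) weight E * \sum_(e in X :\: E) \prod_(v in e) room E v.
Proof.
move=> PQ Qm; rewrite /weight_sum big_distrr /=.
rewrite (eq_bigr (fun E => #|E :&: X| * weight E)) => [|E QE]; last by rewrite (Qm E QE).
rewrite (sum_add_edge _ PQ); apply: eq_bigr => E _; rewrite big_distrr /=.
by apply: eq_bigr => e; rewrite inE => /andP[eE _]; rewrite weight_add.
Qed.

(** A new edge inside S uses an unordered pair of the s half-edges free in S;
    bounding by all such pairs ignores that the graph stays simple. *)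
Lemma weight_sum_in_step S a b c s : s = d * #|S| - (2 * a + c) ->
  2 * a.+1 * weight_sum (split_type S a.+1 b c)
    <= weight_sum (split_type S a b c) * (s * s.-1).
Proof.
move=> ->; rewrite -mulnA (@weight_sum_add (split_type S a b c) _ (pairs_in S)).
- rewrite mulnC /weight_sum !big_distrl /=; apply: leq_sum => E tE.
  have [->//|w0] := posnP (weight E).
  rewrite -mulnA leq_mul2l; apply/orP; right.
  have := sum_pairs_in (room E) S; rewrite (sum_room w0 (split_type_sum_degree tE)).
  apply: leq_trans; rewrite leq_mul2r /=.
  rewrite big_mkcond [leqRHS]big_mkcond /=; apply: leq_sum => e _.
  by rewrite inE; case: (e \in E).
- move=> E e eX eE; rewrite /split_type !card_addI// (simple_add _ (pairs_in_pairs eX)).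
  by rewrite eX (pairs_in_sub eX) (pairs_in_across eX) addn1 !addn0.
- by move=> E /and4P[_ /eqP].
Qed.

Lemma weight_sum_across_step S a b c :
  c.+1 * weight_sum (split_type S a b c.+1)
    <= weight_sum (split_type S a b c) *
       ((d * #|S| - (2 * a + c)) * (d * #|~: S| - (2 * b + c))).
Proof.
rewrite (@weight_sum_add (split_type S a b c) _ (pairs_across S)).
- rewrite /weight_sum !big_distrl /=; apply: leq_sum => E tE.
  have [->//|w0] := posnP (weight E).
  rewrite leq_mul2l; apply/orP; right.
  have := sum_pairs_across (room E) S; rewrite (sum_room w0 (split_type_sum_degree tE)).
  rewrite -split_typeC in tE; rewrite (sum_room w0 (split_type_sum_degree tE)) => <-.
  rewrite big_mkcond [leqRHS]big_mkcond /=; apply: leq_sum => e _.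
  by rewrite inE; case: (e \in E).
- move=> E e eX eE.
  rewrite /split_type !card_addI// (simple_add _ (pairs_across_pairs eX)).
  have -> : e \in pairs_in S = false by apply: contraTF eX => /pairs_in_across ->.
  have -> : e \in pairs_in (~: S) = false.
    by apply: contraTF eX => /pairs_in_across; rewrite pairs_acrossC => ->.
  by rewrite eX addn1 !addn0.
- by move=> E /and4P[_ _ _ /eqP].
Qed.

Lemma weight_sumC S a b c :
  weight_sum (split_type (~: S) b a c) = weight_sum (split_type S a b c).
Proof. by apply: eq_bigl => E; rewrite split_typeC. Qed.

(** The induction step shared by the three inductions of the next lemma. *)
Lemma leq_mul_chain m Z' Z k F r : m * Z' <= Z * r -> Z * k <= F ->
  Z' * (m * k) <= F * r.
Proof.
move=> H1 H2; rewrite mulnA [Z' * m]mulnC; apply: leq_trans (leq_mul H1 (leqnn k)) _.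
by rewrite mulnAC leq_mul.
Qed.

(** Insert the edges inside S, then those inside the complement, then those across.
    The right-hand side counts the ways to pick the half-edges used in S and in its
    complement in order; the factorials and powers of two on the left account for
    the order and the orientation of the edges. *)
Lemma weight_sum_split S a b c :
  weight_sum (split_type S a b c) * (2 ^ a * a`! * (2 ^ b * b`!) * c`!)
    <= (d * #|S|) ^_ (2 * a + c) * (d * #|~: S|) ^_ (2 * b + c).
Proof.
elim: c => [|c IHc]; last first.
  rewrite !addnS !ffactnSr factS.
  have := weight_sum_across_step S a b c; move: IHc.
  move: (weight_sum _) (weight_sum _) (2 ^ a * _ * _) (_ ^_ _) (_ ^_ _) (_ - _) (_ - _) c`!
    => Z' Z k F1 F2 r1 r2 cf H1 H2.
  have := leq_mul_chain H2 H1; lia.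
rewrite !addn0 fact0 muln1.
elim: b => [|b IHb]; last first.
  have := @weight_sum_in_step (~: S) b a 0 _ (erefl _).
  rewrite !weight_sumC addn0.
  rewrite mulnSr addn2 !ffactnSr subnS factS expnS.
  move: IHb.
  move: (weight_sum _) (weight_sum _) (2 ^ a * _) (2 ^ b) (_ ^_ _) (_ ^_ _) (_ - _) b`!
    => Z' Z k k' F1 F2 r1 cf H1 H2.
  have := leq_mul_chain H2 H1; lia.
elim: a => [|a IHa]; last first.
  have := @weight_sum_in_step S a 0 0 _ (erefl _).
  rewrite addn0.
  rewrite [2 * a.+1]mulnSr addn2 !ffactnSr subnS factS expnS.
  move: IHa.
  move: (weight_sum _) (weight_sum _) (2 ^ a) (2 ^ 0 * _) (_ ^_ _) (_ ^_ _) (_ - _) a`!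
    => Z' Z k k' F1 F2 r1 cf H1 H2.
  have := leq_mul_chain H2 H1; lia.
rewrite /weight_sum (big_pred1 set0).
  rewrite /degree_weight big1 ?muln1// => v _.
  by rewrite /degree (_ : [set _ | _] = set0) ?cards0//; apply/setP => e; rewrite !inE.
(* A graph without edges of any of the three types is empty. *)
move=> E /=; apply/and4P/eqP
  => [[sE /eqP/cards0_eq h1 /eqP/cards0_eq h2 /eqP/cards0_eq h3]|->].
  apply/setP => e; rewrite inE; apply/negP => eE.
  move: sE; rewrite simple_graphE => /subsetP/(_ e eE)/(pairs_cover S).
  move/setP/(_ e): h1; move/setP/(_ e): h2; move/setP/(_ e): h3.
  by rewrite !in_setI eE /= !in_set0 => -> -> ->.
by rewrite !set0I cards0 simple_graphE sub0set.
Qed.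

End UpperCount.

(** * Counting graphs from below *)

Section LowerCount.
Variables (T : finType) (d : nat).
Implicit Types (E : {set {set T}}) (e S : {set T}) (u v : T).
Local Notation weight := (@degree_weight T d).
Local Notation room := (@room T d).

Definition simple_size t E := simple_graph E && (#|E| == t).

Lemma sum_degreeT E : simple_graph E -> \sum_v degree E v = 2 * #|E|.
Proof.
rewrite simple_graphE => /subsetP sE.
rewrite (eq_bigl (mem [set: T])); last by move=> v; rewrite /= in_setT.
rewrite sum_degree mulnC -sum_nat_const; apply: eq_bigr => e /sE.
by rewrite inE setIT => /eqP.
Qed.

Lemma sum_roomT E : simple_graph E -> 0 < weight E ->
  \sum_v room E v = d * #|T| - 2 * #|E|.
Proof.
move=> sE w0; rewrite -sum_degreeT// -cardsT.
have := @sum_room T d [set: T] _ E w0 (erefl _).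
by rewrite ![\sum_(v in [set: T]) _](eq_bigl predT)// => v; rewrite /= in_setT.
Qed.

Lemma set2_inj u : injective (fun v => [set u; v]).
Proof.
move=> v w /= /setP H; have := H v; have := H w; rewrite !inE !eqxx !orbT.
by move=> /orP[/eqP ->|/eqP //] /esym/orP[/eqP //|/eqP].
Qed.

Lemma card_neighbours E u : #|[set v | [set u; v] \in E]| <= degree E u.
Proof.
rewrite /degree -(card_imset _ (@set2_inj u)).
apply/subset_leq_card/subsetP => _ /imsetP[v + ->].
by rewrite !inE eqxx => ->.
Qed.

(** Given a free half-edge at u, the partners that would create a loop or a repeated
    edge sit at u or at one of its at most d neighbours, which carry at most
    d(d+1) half-edges. *)
Lemma sum_free_pairs E : simple_graph E -> 0 < weight E ->
  let r := d * #|T| - 2 * #|E| in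
  r * (r - d * d.+1) <= (\sum_(e in pairs T :\: E) \prod_(v in e) room E v) * 2.
Proof.
move=> sE w0 /=; set r := _ - _.
rewrite big_mkcond /=.
have -> : \sum_i (if i \in pairs T :\: E then \prod_(v in i) room E v else 0) =
          \sum_(e in pairs T) (if e \notin E then \prod_(v in e) room E v else 0).
  rewrite [RHS]big_mkcond /=; apply: eq_bigr => e _.
  by rewrite in_setD andbC; case: (e \in pairs T).
rewrite sum_pairs /r -sum_roomT// big_distrl /=; apply: leq_sum => u _.
pose far v := (v != u) && ([set u; v] \notin E).
apply: (@leq_trans (\sum_(v | far v) room E u * room E v)); last first.
  rewrite big_mkcondr /=; apply: leq_sum => v vu.
  by case: ifP => // _; rewrite prod_pair.
rewrite -big_distrr /= leq_mul2l; apply/orP; right.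
rewrite (bigID far) /= leq_subLR addnC leq_add2r.
apply: (@leq_trans (\sum_(v in u |: [set v | [set u; v] \in E]) d)).
  apply: (@leq_trans (\sum_(v in u |: [set v | [set u; v] \in E]) room E v)).
    rewrite leq_eqVlt; apply/orP; left; apply/eqP.
    by apply: eq_bigl => v; rewrite !inE negb_and !negbK.
  by apply: leq_sum => v _; rewrite leq_subr.
rewrite sum_nat_const mulnC leq_mul2l; apply/orP; right.
apply: leq_trans (leq_card_setU _ _) _; rewrite cards1 add1n ltnS.
exact: leq_trans (card_neighbours E u) (weight_gt0 _ w0).
Qed.

Lemma weight_sum_size_step t r : r = d * #|T| - 2 * t ->
  weight_sum d (simple_size t) * (r * (r - d * d.+1))
    <= 2 * t.+1 * weight_sum d (simple_size t.+1).
Proof.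
move=> ->; rewrite -mulnA (@weight_sum_add T d (simple_size t) _ (pairs T)).
  rewrite mulnC {1}/weight_sum !big_distrr /=.
  apply: leq_sum => E /andP[sE /eqP tE].
  have [->|w0] := posnP (weight E); first by rewrite muln0.
  rewrite [leqLHS]mulnC [leqRHS]mulnCA leq_mul2l; apply/orP; right; rewrite [leqRHS]mulnC.
  by have := sum_free_pairs sE w0; rewrite tE.
- move=> E e eX eE; rewrite /simple_size (simple_add _ eX) cardsU1 eE.
  by rewrite add1n eqSS.
- by move=> E /andP[]; rewrite simple_graphE => /setIidPl -> /eqP.
Qed.

(** With 2s = d(d+1), the step from t to t+1 edges gains at least the factor
    2(M - t)(M - t - s) / (t + 1); the product of these factors for t < M - s
    telescopes to 2^(M - s) M! / s!. *)
Lemma weight_sum_size M s : d * #|T| = 2 * M -> d * d.+1 = 2 * s -> s <= M ->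
  2 ^ (M - s) * M`! <= s`! * weight_sum d (simple_size (M - s)).
Proof.
move=> HM Hs sM.
suff H t : t <= M - s -> 2 ^ t * M`! * (M - s)`! <=
    weight_sum d (simple_size t) * t`! * ((M - t)`! * (M - t - s)`!).
  have := H _ (leqnn _); rewrite subKn// subnn fact0 muln1 => {}H.
  rewrite -(leq_pmul2r (fact_gt0 (M - s))); move: H.
  by move: (2 ^ _) M`! (M - s)`! s`! (weight_sum _ _) => p a b c w; lia.
elim: t => [_|t IH tM].
  rewrite !subn0 expn0 mul1n fact0 muln1 -[leqLHS]mul1n leq_mul2r.
  apply/orP; right; rewrite /weight_sum (bigD1 set0) /=; last first.
    by rewrite /simple_size simple_graphE sub0set cards0.
  apply: leq_trans (leq_addr _ _); rewrite /degree_weight prodn_gt0// => v.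
  by rewrite /degree (_ : [set _ | _] = set0) ?cards0//; apply/setP => e; rewrite !inE.
have {}IH := IH (ltnW tM); have := @weight_sum_size_step t _ (erefl _).
(* With m = M - t - s - 1 no truncated subtraction remains below. *)
have [m Em] : exists m, M = (t + s + m).+1 by exists (M - t - s).-1; lia.
rewrite HM Hs.
have -> : 2 * M - 2 * t = 2 * (s + m).+1 by lia.
have -> : 2 * (s + m).+1 - 2 * s = 2 * m.+1 by lia.
move: IH; have -> : M - t = (s + m).+1 by lia.
have -> : M - t.+1 = s + m by lia.
have -> : s + m - s = m by lia.
have -> : (s + m).+1 - s = m.+1 by lia.
rewrite !factS expnS.
move: (weight_sum _ _) (weight_sum _ _) (2 ^ t) M`! (M - s)`! t`! (s + m)`! m`!
  => Z Z' p F G tf f1 f2 H1 H2.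
rewrite -(leq_pmul2l (isT : 0 < 2)).
have := leq_mul H2 (leqnn (tf * (f1 * f2))).
by move: H1; set A := Z * _ * _; set B := _ * _; nia.
Qed.
End LowerCount.

(** * Completing almost regular graphs *)

Section Completion.
Variables (T : finType) (d : nat).
Implicit Types (E : {set {set T}}) (e S : {set T}) (u v a b : T).

(** Graphs with t edges that a few replacements will make d-regular. *)
Definition subregular t : {set {set {set T}}} :=
  [set E | simple_size t E && [forall v, degree E v <= d]].

Lemma weight_sum_subregular t :
  weight_sum d (@simple_size T t) <= d`! ^ #|T| * #|subregular t|.
Proof.
rewrite mulnC -sum_nat_const /weight_sum big_mkcond [leqRHS]big_mkcond /=.
apply: leq_sum => E _; rewrite inE; case: ifP => //= sE; case: ifP => [_|/forallP H].
  exact: weight_le.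
rewrite leqn0; apply: contraT; rewrite -lt0n => w0; case: H => v.
exact: weight_gt0 w0.
Qed.

(** The vertices u and v may coincide, in which case u misses two edges. *)
Lemma ex_deficient_pair E : simple_graph E -> (forall v, degree E v <= d) ->
  2 * #|E|.+1 <= d * #|T| ->
  exists u v, forall w, degree E w + (w == u) + (w == v) <= d.
Proof.
move=> sE dE; move Em: #|E| => m; move En: #|T| => n tE.
have total : \sum_v (d - degree E v) + 2 * m = d * n.
  rewrite -Em -En -sum_degreeT// -big_split /= mulnC -sum_nat_const.
  by apply: eq_bigr => v _; rewrite subnK.
have [u hu] : exists u, 0 < d - degree E u.
  apply/existsP; apply: contraT; rewrite negb_exists => /forallP H.
  by move: total; rewrite big1; [lia|move=> v _; move: (H v); lia].
have [hu2|hu2] := leqP 2 (d - degree E u).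
  exists u, u => w; have := dE w; case: eqP => [->|_] /=; lia.
have [v hv] : exists v, (v != u) && (0 < d - degree E v).
  apply/existsP; apply: contraT; rewrite negb_exists => /forallP H.
  move: total; rewrite (bigD1 u)//= big1 => [|v vu]; last first.
    by move: (H v); rewrite vu /=; lia.
  by rewrite addn0 => {H} tot; lia.
case/andP: hv => vu hv; exists u, v => w; have := dE w.
case: (eqVneq w u) => [->|_]; first by rewrite eq_sym (negPf vu); lia.
by case: eqP => [->|_] /=; lia.
Qed.

(** Fewer than #|E| edges meet B, as each vertex lies on at most d edges. *)
Lemma ex_edge_avoiding E (B : {set T}) : simple_graph E ->
  (forall v, degree E v <= d) -> #|B| * d < #|E| ->
  exists a b, [/\ a != b, [set a; b] \in E, a \notin B & b \notin B].
Proof.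
rewrite simple_graphE => /subsetP sE dE lt.
have [e eE eB] : exists2 e, e \in E & #|e :&: B| == 0.
  apply/exists_inP; apply: contraT; rewrite negb_exists_in => /forall_inP H.
  suff : #|E| <= #|B| * d by rewrite leqNgt lt.
  apply: (@leq_trans (\sum_(v in B) degree E v)).
    by rewrite sum_degree -sum1_card; apply: leq_sum => e /H; rewrite lt0n.
  by rewrite -sum_nat_const; apply: leq_sum => v _.
have := sE _ eE; rewrite inE => /cards2P[a [b [ab eab]]].
exists a, b; rewrite -eab; split=> //; apply: contraTN eB => h; rewrite cards_eq0;
  apply/set0Pn; [exists a|exists b]; by rewrite inE h eab !inE eqxx ?orbT.
Qed.

(** Replacing the edge ab by ua and vb raises the degrees of u and v by one and
    keeps those of a and b; [unsplice] undoes it. *)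
Definition splice u v a b E := [set u; a] |: ([set v; b] |: (E :\ [set a; b])).
Definition unsplice u v a b E := [set a; b] |: ((E :\ [set u; a]) :\ [set v; b]).

(** The edge ab is chosen away from u, v and their neighbours, so that ua and vb are
    new edges.  At most 2(d+1) vertices have to be avoided. *)
Lemma ex_splice E t : E \in subregular t -> 2 * t.+1 <= d * #|T| ->
  2 * d.+1 * d < t ->
  exists u v a b, splice u v a b E \in subregular t.+1 /\
    unsplice u v a b (splice u v a b E) = E.
Proof.
rewrite inE => /andP[/andP[sE /eqP <-] /forallP dE] tE big.
have [u [v huv]] := ex_deficient_pair sE dE tE.
pose N w := w |: [set x | [set w; x] \in E].
have cN w : #|N w| <= d.+1.
  apply: leq_trans (leq_card_setU _ _) _; rewrite cards1 add1n ltnS.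
  exact: leq_trans (card_neighbours E w) (dE w).
have [|a [b [ab abE]]] := @ex_edge_avoiding E (N u :|: N v) sE dE.
  apply: leq_ltn_trans big; rewrite leq_mul2r; apply/orP; right.
  by apply: leq_trans (leq_card_setU _ _) _; rewrite mul2n -addnn leq_add.
rewrite !inE !negb_or => /andP[/andP[au uaE] /andP[av vaE]].
move=> /andP[/andP[bu ubE] /andP[bv vbE]].
exists u, v, a, b.
have vbE' : [set v; b] \notin E :\ [set a; b] by rewrite inE (negPf vbE) andbF.
have uavb : [set u; a] != [set v; b].
  apply/eqP => /setP/(_ a); rewrite !inE eqxx orbT (negPf av) (negPf ab) //.
have uaE' : [set u; a] \notin [set v; b] |: (E :\ [set a; b]).
  by rewrite !inE (negPf uavb) (negPf uaE) andbF.
split; last first.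
  rewrite /unsplice /splice setU1K// setU1K// setD1K//.
rewrite inE /simple_size /splice.
rewrite !simple_add ?inE ?cards2 1?(eq_sym u) 1?(eq_sym v) ?au ?bv//.
have -> /= : simple_graph (E :\ [set a; b]).
  by move: sE; rewrite !simple_graphE; apply: subset_trans; rewrite subsetDl.
rewrite !cardsU1 uaE' vbE' (cardsD1 [set a; b] E) abE /= eqxx /=.
apply/forallP => w; rewrite !degree_add//.
apply: leq_trans (huv w).
have := @degree_add T (E :\ [set a; b]) [set a; b] w.
rewrite setD1K// !inE eqxx => /(_ isT) ->.
have : ~~ ((w == a) && (w == b)) by apply: contra ab => /andP[/eqP <- /eqP <-].
by rewrite -!addnA leq_add2l; case: (w == a) (w == b) (w == u) (w == v) => [] [] [] [].
Qed.

(** A graph is recovered from its splice and the four vertices involved. *)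
Lemma card_subregular_step t : 2 * t.+1 <= d * #|T| -> 2 * d.+1 * d < t ->
  #|subregular t| <= #|T| ^ 4 * #|subregular t.+1|.
Proof.
move=> tT big.
pose code (p : T * T * (T * T) * {set {set T}}) :=
  let: (u, v, (a, b), E) := p in unsplice u v a b E.
have sub : subregular t \subset code @: setX [set: T * T * (T * T)] (subregular t.+1).
  apply/subsetP => E /ex_splice/(_ tT big)[u [v [a [b [H1 H2]]]]].
  apply/imsetP; exists (u, v, (a, b), splice u v a b E); last by rewrite /= H2.
  by rewrite inE /= in_setT.
apply: leq_trans (subset_leq_card sub) _.
apply: leq_trans (leq_imset_card _ _) _.
rewrite cardsX cardsT !card_prod leq_mul2r; apply/orP; right.
by rewrite !expnS expn0 muln1 !mulnA.
Qed.

Lemma card_subregular M s : d * #|T| = 2 * M -> 2 * d.+1 * d + s < M ->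
  #|subregular (M - s)| <= #|T| ^ (4 * s) * #|subregular M|.
Proof.
move=> HM big.
suff H j : j <= s -> #|subregular (M - s)| <= #|T| ^ (4 * j) * #|subregular (M - s + j)|.
  by have := H s (leqnn s); rewrite subnK//; lia.
elim: j => [_|j IH js]; first by rewrite muln0 expn0 mul1n addn0.
apply: leq_trans (IH (ltnW js)) _.
rewrite mulnS expnD [#|T| ^ 4 * _]mulnC -mulnA leq_mul2l; apply/orP; right.
by rewrite addnS; apply: card_subregular_step; lia.
Qed.

Lemma regular_size M E : d * #|T| = 2 * M -> regular_graph d E -> #|E| = M.
Proof.
move=> HM /andP[sE /forallP H]; have := sum_degreeT sE.
rewrite (eq_bigr (fun=> d)) => [|v _]; last exact/eqP.
by rewrite sum_nat_const mulnC HM => /eqP; rewrite eqn_pmul2l// => /eqP.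
Qed.

Lemma subregular_regular M E : d * #|T| = 2 * M -> E \in subregular M ->
  regular_graph d E.
Proof.
rewrite inE => HM /andP[/andP[sE /eqP HE] /forallP dE]; rewrite /regular_graph sE /=.
apply/forallP => v; rewrite eqn_leq dE /= leqNgt; apply/negP => lt.
have : \sum_w degree E w < \sum_(w : T) d.
  rewrite (bigD1 v)//= [ltnRHS](bigD1 v)//= -addSn; apply: leq_add => //.
  by apply: leq_sum => w _; exact: dE.
by rewrite sum_degreeT// HE sum_nat_const mulnC [_ * d]mulnC HM mulnC ltnn.
Qed.

Lemma card_regular_graphs_ge M s :
  d * #|T| = 2 * M -> d * d.+1 = 2 * s -> 2 * d.+1 * d + s < M ->
  2 ^ (M - s) * M`! <=
    s`! * #|T| ^ (4 * s) *
      (d`! ^ #|T| * #|[set E : {set {set T}} | regular_graph d E]|).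
Proof.
move=> HM Hs big; have sM : s <= M by lia.
apply: leq_trans (weight_sum_size HM Hs sM) _.
rewrite -mulnA leq_mul2l; apply/orP; right.
apply: leq_trans (weight_sum_subregular _) _.
rewrite mulnCA leq_mul2l; apply/orP; right.
apply: leq_trans (card_subregular HM big) _.
rewrite leq_mul2l; apply/orP; right; apply/subset_leq_card/subsetP => E.
move=> /(subregular_regular HM).
by rewrite inE.
Qed.

(** In a regular graph the degree sums over S and over its complement determine b and
    c from a. *)
Lemma regular_split S E (a : nat) : regular_graph d E ->
  edges_inside E S = a -> exists b c : nat,
  [/\ split_type S a b c E, 2 * a + c = d * #|S| & 2 * b + c = d * #|~: S|].
Proof.
move=> rE aE; have /andP[sE /forallP dE] := rE.
pose b := #|E :&: pairs_in (~: S)|; pose c := #|E :&: pairs_across S|.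
have tE : split_type S a b c E.
  apply/and4P; split=> //; apply/eqP; rewrite -aE /edges_inside; congr #|pred_of_set _|.
  apply/setP => e; rewrite !inE; case: (boolP (e \in E)) => //= eE.
  by move: sE; rewrite simple_graphE => /subsetP/(_ e eE); rewrite inE => ->.
exists b, c; split=> //.
  rewrite -(split_type_sum_degree tE) (eq_bigr (fun=> d)) => [|v _]; last exact/eqP.
  by rewrite sum_nat_const mulnC.
rewrite -split_typeC in tE.
rewrite -(split_type_sum_degree tE) (eq_bigr (fun=> d)) => [|v _]; last exact/eqP.
by rewrite sum_nat_const mulnC.
Qed.

Lemma card_regular_split S (a b c : nat) :
  2 * a + c = d * #|S| -> 2 * b + c = d * #|~: S| ->
  #|[set E : {set {set T}} | regular_graph d E && (edges_inside E S == a)]|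
    * d`! ^ #|T| * (2 ^ a * a`! * (2 ^ b * b`!) * c`!)
  <= (d * #|S|)`! * (d * #|~: S|)`!.
Proof.
move=> Ha Hb.
have := weight_sum_split d S a b c; rewrite Ha Hb !ffactnn; apply: leq_trans.
rewrite leq_mul2r; apply/orP; right; rewrite -sum_nat_const /weight_sum.
rewrite big_mkcond [leqRHS]big_mkcond /=; apply: leq_sum => E _; rewrite inE.
case: ifP => // /andP[rE /eqP aE].
have [b' [c' [tE Ha' Hb']]] := regular_split rE aE.
have cc : c' = c by lia.
have bb : b' = b by lia.
by rewrite -bb -cc tE weight_regular.
Qed.

End Completion.

(** * Modularity is controlled by the densities of large sets *)

Local Open Scope ring_scope.

Section Merging.
Variables (T : finType) (d : nat) (E : {set {set T}}).
Implicit Types (A B : {set T}).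
Hypothesis rE : regular_graph d E.

Lemma edges_inside_le A : (2 * edges_inside E A <= d * #|A|)%N.
Proof.
have /andP[sE /forallP dE] := rE.
have <- : (\sum_(v in A) degree E v = d * #|A|)%N.
  rewrite mulnC -sum_nat_const; apply: eq_bigr => v _; exact/eqP.
rewrite sum_degree mulnC -sum_nat_const big_mkcond [leqRHS]big_mkcond /=.
apply: leq_sum => e _.
rewrite inE; case: ifP => // /andP[eE /setIidPl ->]; rewrite eE.
by move: sE; rewrite simple_graphE => /subsetP/(_ e eE); rewrite inE => /eqP ->.
Qed.

Lemma edges_insideU A B : [disjoint A & B] ->
  (edges_inside E A + edges_inside E B <= edges_inside E (A :|: B))%N.
Proof.
move=> dAB; have /andP[sE _] := rE.
rewrite /edges_inside -cardsUI [X in (_ + X)%N](_ : _ = 0%N).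
  rewrite addn0; apply/subset_leq_card/subsetP => e.
  rewrite !inE => /orP[] /andP[-> h] /=.
    exact: subset_trans h (subsetUl _ _).
  exact: subset_trans h (subsetUr _ _).
apply/eqP; rewrite cards_eq0; apply/eqP/setP => e; rewrite !inE.
apply/negP => /andP[/andP[eE eA] /andP[_ eB]].
have e0 : e \subset set0 by rewrite -(setI_eq0 A B) in dAB; rewrite -(eqP dAB) subsetI eA.
move: sE; rewrite simple_graphE => /subsetP/(_ e eE); rewrite inE.
by move: e0; rewrite subset0 => /eqP ->; rewrite cards0.
Qed.

Variable R : realType.
Variable M : nat.
Hypotheses (HM : (d * #|T| = 2 * M)%N) (M0 : (0 < M)%N).

Let q A : R := (edges_inside E A)%:R / M%:R.
Let w A : R := #|A|%:R / #|T|%:R.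

Let T0 : (0 < #|T|)%N.
Proof. by rewrite lt0n; apply/eqP => T0; move: HM M0; rewrite T0; lia. Qed.
Let d0 : (0 < d)%N.
Proof. by rewrite lt0n; apply/eqP => d0; move: HM M0; rewrite d0; lia. Qed.
Let TR : 0 < #|T|%:R :> R. Proof. by rewrite ltr0n T0. Qed.
Let MR : 0 < M%:R :> R. Proof. by rewrite ltr0n M0. Qed.
Let dR : 0 < d%:R :> R. Proof. by rewrite ltr0n d0. Qed.
Let HMR : d%:R * #|T|%:R = 2 * M%:R :> R. Proof. by rewrite -!natrM HM. Qed.

Let w_ge0 A : 0 <= w A. Proof. by rewrite divr_ge0. Qed.

Lemma inside_le_weight A : q A <= w A.
Proof.
rewrite /q /w ler_pdivrMr// mulrAC ler_pdivlMr//.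
have := edges_inside_le A; rewrite -(ler_nat R) !natrM => H.
rewrite -(ler_pM2l dR); apply: (@le_trans _ _ (2 * (edges_inside E A)%:R * M%:R)).
  by rewrite mulrCA HMR mulrCA mulrA.
by rewrite mulrA ler_pM2r.
Qed.

Lemma modularity_summand A :
  (edges_inside E A)%:R / #|E|%:R -
    (\sum_(v in A) degree E v)%N%:R ^+ 2 / (4%:R * #|E|%:R ^+ 2)
  = q A - w A ^+ 2.
Proof.
have /andP[sE /forallP dE] := rE.
rewrite (eq_bigr (fun=> d)) => [|v _]; last exact/eqP.
rewrite sum_nat_const (regular_size HM rE); congr (_ - _).
rewrite natrM /w expr_div_n.
have -> : M%:R = d%:R * #|T|%:R / 2 :> R by rewrite HMR; field.
by move: TR dR; move: #|T|%:R #|A|%:R d%:R => t a D t0 D0; field; rewrite !gt_eqF.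
Qed.

Variables (beta delta : R).
Hypotheses (beta0 : 0 <= beta)
  (sparse : forall A, delta <= w A -> q A <= w A * (beta + w A)).

(** B is the union of the blocks merged so far.  As soon as it reaches weight delta
    it is released: its weight is then at most 2 delta, so that its density is at most
    beta + 2 delta.  The summand delta pays for the last, incomplete union. *)
Lemma small_blocks (l : seq {set T}) B : w B < delta ->
  all (fun A => w A < delta) l -> pairwise (fun A A' => [disjoint A & A']) (B :: l) ->
  q B + \sum_(A <- l) q A <= (beta + 2 * delta) * (w B + \sum_(A <- l) w A) + delta.
Proof.
have delta0 : forall B, w B < delta -> 0 <= delta.
  by move=> B' /ltW; apply: le_trans.
elim: l B => [|A l IH] B wB.
  rewrite !big_nil !addr0 => _ _; apply: le_trans (inside_le_weight B) _.
  apply: ler_wpDl; last exact: ltW.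
  by rewrite mulr_ge0// addr_ge0// mulr_ge0// (delta0 B).
move=> /= /andP[wA al] /andP[/andP[BA Bl] /andP[Al pl]].
rewrite !big_cons.
have wU : w (B :|: A) = w B + w A.
  by rewrite /w -mulrDl -natrD cardsU disjoint_setI0// cards0 subn0.
have qU : q B + q A <= q (B :|: A).
  by rewrite /q -mulrDl -natrD ler_pM2r ?invr_gt0// ler_nat edges_insideU.
have [wBA|wBA] := ltP (w (B :|: A)) delta.
  have := IH _ wBA al; rewrite /= pl andbT wU => H.
  rewrite !addrA; apply: le_trans (H _); first by rewrite lerD2r.
  apply/allP => C Cl; rewrite disjoints_subset subUset -!disjoints_subset.
  by rewrite (allP Bl) ?(allP Al).
have w0 : w set0 = 0 by rewrite /w cards0 mul0r.
have q0 : q set0 = 0.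
  have := inside_le_weight set0; rewrite w0 => H; apply/eqP; rewrite eq_le H /=.
  by rewrite divr_ge0.
have := IH set0; rewrite w0 q0 !add0r => /(_ _ al) H.
have {}H : \sum_(A <- l) q A <= (beta + 2 * delta) * \sum_(A <- l) w A + delta.
  apply: H; first exact: le_lt_trans wB.
  by rewrite /= pl andbT; apply/allP => C _; rewrite disjoints_subset sub0set.
have : w (B :|: A) * (beta + w (B :|: A)) <= w (B :|: A) * (beta + 2 * delta).
  by rewrite ler_wpM2l// lerD2l wU mulr_natl mulr2n lerD// ltW.
move/(le_trans (sparse wBA))/(le_trans qU); rewrite wU => H2.
rewrite addrA; apply: le_trans (lerD H2 H) _.
by rewrite le_eqVlt; apply/orP; left; apply/eqP; ring.
Qed.

Lemma partition_modularity_le P : 0 < delta -> partition P [set: T] ->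
  partition_modularity R E P <= beta + 3 * delta.
Proof.
move=> delta_gt0 partP; rewrite /partition_modularity.
rewrite (eq_bigr _ (fun A _ => modularity_summand A)).
pose small A := w A < delta.
have wP : \sum_(A in P) w A = 1.
  by rewrite -mulr_suml -natr_sum -(card_partition partP) cardsT divff// gt_eqF.
have big : \sum_(A in P | ~~ small A) (q A - w A ^+ 2) <=
    beta * \sum_(A in P | ~~ small A) w A.
  rewrite mulr_sumr; apply: ler_sum => A /andP[_]; rewrite -leNgt => /sparse.
  by rewrite lerBlDr mulrDr -expr2 mulrC.
pose l := enum [set A in P | small A].
have lE (g : {set T} -> R) : \sum_(A in P | small A) g A = \sum_(A <- l) g A.
  by rewrite /l big_enum_cond /=; apply: eq_bigl => A; rewrite inE andbT.
have w0 : w set0 = 0 by rewrite /w cards0 mul0r.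
have few : \sum_(A in P | small A) (q A - w A ^+ 2)
   <= (beta + 2 * delta) * \sum_(A in P | small A) w A + delta.
  apply: (@le_trans _ _ (\sum_(A in P | small A) q A)).
    by apply: ler_sum => A _; rewrite lerBlDr lerDl sqr_ge0.
  rewrite !lE; have q0 : 0 <= q set0 by rewrite divr_ge0.
  have := @small_blocks l set0; rewrite w0 add0r => H.
  apply: le_trans (H _ _ _); rewrite ?lerDr//.
    by apply/allP => A; rewrite mem_enum inE => /andP[].
  rewrite /=; apply/andP; split.
    by apply/allP => C _; rewrite disjoints_subset sub0set.
  apply/(pairwiseP set0) => i j; rewrite !inE => il jl ij.
  have /and3P[_ /trivIsetP tP _] := partP; apply: tP.
  - by have := mem_nth set0 il; rewrite mem_enum inE => /andP[].
  - by have := mem_nth set0 jl; rewrite mem_enum inE => /andP[].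
  - by rewrite nth_uniq ?enum_uniq// neq_ltn ij.
have w_big : 0 <= \sum_(A in P | ~~ small A) w A by apply: sumr_ge0.
rewrite (bigID small) /=; rewrite (bigID small) /= in wP.
apply: le_trans (lerD few big) _.
have -> : beta + 3 * delta = (beta + 2 * delta) * 1 + delta by ring.
rewrite addrAC lerD2r -[X in _ <= _ * X]wP mulrDr lerD2l ler_wpM2r//.
by rewrite lerDl mulr_ge0// ltW.
Qed.

Lemma modularity_le : 0 < delta -> modularity R E <= beta + 3 * delta.
Proof.
move=> delta_gt0; have [P partP ->] := modularity_attained R E.
exact: partition_modularity_le.
Qed.

End Merging.

From mathcomp Require Import all_classical all_reals all_analysis.
Import numFieldNormedType.Exports.

(** * The exponent f and its largest zero *)

Section XLogX.
Local Open Scope classical_set_scope.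
Variable R : realType.
Implicit Types x y z u v : R.

(** As ln vanishes on nonpositive numbers, this function is continuous on the whole
    line; this makes f continuous without any restriction on its arguments. *)
Definition xlnx x := x * ln x.

Lemma xlnxM u v : 0 <= u -> 0 <= v -> xlnx (u * v) = u * xlnx v + v * xlnx u.
Proof.
rewrite /xlnx !le_eqVlt => /predU1P[<-|u0] /predU1P[<-|v0];
  rewrite ?(mul0r, mulr0, add0r, addr0)//.
by rewrite lnM ?posrE//; ring.
Qed.

(** With s the square root of z, -ln s <= 1/s, and ln z = 2 ln s. *)
Lemma normr_xlnx_le z : 0 < z -> z <= 1 -> `|xlnx z| <= 2 * Num.sqrt z.
Proof.
move=> z0 z1; have s0 : 0 < Num.sqrt z by rewrite sqrtr_gt0.
have zE : z = Num.sqrt z ^+ 2 by rewrite sqr_sqrtr// ltW.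
rewrite /xlnx normrM (ler0_norm (ln_le0 z1)) (gtr0_norm z0).
set s := Num.sqrt z in s0 zE *.
have lns : - ln s <= s^-1.
  by rewrite -lnV ?posrE// ltW// ln_sublinear// invr_gt0.
have -> : z * - ln z = s * (s * (2 * - ln s)).
  by rewrite zE lnXn//; ring.
rewrite [leRHS]mulrC ler_pM2l//.
have := ler_pM2l s0 (- ln s) s^-1; rewrite lns divff ?gt_eqF// => /idP.
by move=> ?; lra.
Qed.

Lemma continuous_xlnx : continuous xlnx.
Proof.
move=> z; have [z0|z0|->] := ltgtP z 0.
- apply: (@near_cst_continuous _ _ 0) => //; near=> t.
  by rewrite /xlnx ln0 ?mulr0// ltW//; near: t; exact: lt_nbhsl.
- by apply: cvgM; [exact: cvg_id|exact: continuous_ln].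
have x0 : xlnx 0 = 0 by rewrite /xlnx mul0r.
rewrite /continuous_at x0; apply/cvgrPdist_le => /= e e0.
have e2 : 0 < (2^-1 * e) ^+ 2 by rewrite exprn_gt0// mulr_gt0// invr_gt0.
have near1 := @nbhs0_lt R R 1 ltr01; have near2 := @nbhs0_lt R R _ e2.
near=> t; rewrite sub0r normrN; have [t0|t0] := leP t 0.
  by rewrite /xlnx ln0// mulr0 normr0 ltW.
have tN : `|t| = t by rewrite gtr0_norm.
apply: le_trans (normr_xlnx_le t0 _) _.
  by rewrite -tN ltW//; near: t.
rewrite -ler_pdivlMl// -[leRHS]ger0_norm ?mulr_ge0 ?invr_ge0// ?ltW//.
rewrite -sqrtr_sqr ltr_sqrt// -tN.
by near: t.
Unshelve. all: by end_near. Qed.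

End XLogX.

Section Exponent.
Local Open Scope classical_set_scope.
Variable R : realType.
Implicit Types x y d : R.
Local Notation h := (@xlnx R).

Lemma fE x y d : f x y d =
  (y / 2 - 1) * h x + (d - 1) * h (1 - x) + 1 / 2 * h d - x / 2 * h y
  - x * h (d - y) - 1 / 2 * h (d - 2 * x * d + x * y).
Proof. by rewrite /f /xlnx; ring. Qed.

Lemma continuous_f d : continuous (fun p : R * R => f p.1 p.2 d).
Proof.
have c1 : continuous (fun p : R * R => p.1) by move=> p; exact: cvg_fst.
have c2 : continuous (fun p : R * R => p.2) by move=> p; exact: cvg_snd.
have cc (c : R) : continuous (fun _ : R * R => c) by exact: cst_continuous.
have cD (u v : R * R -> R) : continuous u -> continuous v ->
    continuous (fun p => u p + v p).
  by move=> cu cv p; apply: cvgD; [exact: cu|exact: cv].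
have cN (u : R * R -> R) : continuous u -> continuous (fun p => - u p).
  by move=> cu p; apply: cvgN; exact: cu.
have cM (u v : R * R -> R) : continuous u -> continuous v ->
    continuous (fun p => u p * v p).
  by move=> cu cv p; apply: cvgM; [exact: cu|exact: cv].
have ch (u : R * R -> R) : continuous u -> continuous (fun p => h (u p)).
  by move=> cu p; exact: (continuous_comp (cu p) (@continuous_xlnx R (u p))).
rewrite (_ : (fun p => _) = fun p : R * R =>
  (p.2 / 2 - 1) * h p.1 + (d - 1) * h (1 - p.1) + 1 / 2 * h d - p.1 / 2 * h p.2
  - p.1 * h (d - p.2) - 1 / 2 * h (d - 2 * p.1 * d + p.1 * p.2)); last first.
  by apply/funext => p; exact: fE.
have t1 := cM _ _ (cD _ _ (cM _ _ c2 (cc 2^-1)) (cc (-1))) (ch _ c1).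
have t2 := cM _ _ (cc (d - 1)) (ch _ (cD _ _ (cc 1) (cN _ c1))).
have t3 := cN _ (cM _ _ (cM _ _ c1 (cc 2^-1)) (ch _ c2)).
have t4 := cN _ (cM _ _ c1 (ch _ (cD _ _ (cc d) (cN _ c2)))).
have t5 := cN _ (cM _ _ (cc (1 / 2)) (ch _ (cD _ _ (cD _ _ (cc d)
  (cN _ (cM _ _ (cM _ _ (cc 2) c1) (cc d)))) (cM _ _ c1 c2)))).
exact: (cD _ _ (cD _ _ (cD _ _ (cD _ _ (cD _ _ t1 t2) (cc (1 / 2 * h d))) t3) t4) t5).
Qed.

Lemma continuous_f_y x d : continuous (fun y => f x y d).
Proof.
move=> y; apply: (@continuous_comp _ _ _ (fun y => (x, y))
  (fun p : R * R => f p.1 p.2 d)).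
  exact: (cvg_pair (@cst_continuous R R x y) (@cvg_id R (nbhs y))). 
exact: continuous_f.
Qed.

(** At y = xd, the density of a typical set, f is the entropy of x. *)
Lemma f_gt0_mean x d : 0 < x < 1 -> 0 < d -> 0 < f x (x * d) d.
Proof.
move=> x01 d0; have /andP[x0 x1] := x01.
have xC : 0 < 1 - x by rewrite subr_gt0.
have lnx : ln x < 0 by exact: ln_lt0.
have lnxC : ln (1 - x) < 0 by rewrite ln_lt0// xC ltrBlDr ltrDl.
suff -> : f x (x * d) d = x * - ln x + (1 - x) * - ln (1 - x).
  by rewrite addr_gt0// mulr_gt0// oppr_gt0.
have -> : f x (x * d) d = x * (x * d / 2 - 1) * ln x + (1 - x) * (d - 1) * ln (1 - x)
   + 1 / 2 * d * ln d - 1 / 2 * x * (x * d) * ln (x * d)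
   - x * (d * (1 - x)) * ln (d * (1 - x))
   - 1 / 2 * (d * ((1 - x) * (1 - x))) * ln (d * ((1 - x) * (1 - x))).
  rewrite /f; have -> : d - x * d = d * (1 - x) by ring.
  by have -> : d - 2 * x * d + x * (x * d) = d * ((1 - x) * (1 - x)) by ring.
by rewrite !lnM ?posrE ?mulr_gt0//; field.
Qed.

(** At y = d, where no edge leaves the set, f is a negative multiple of the entropy
    of x. *)
Lemma f_lt0_clique x d : 0 < x < 1 -> 2 < d -> f x d d < 0.
Proof.
move=> x01 d2; have /andP[x0 x1] := x01.
have d0 : 0 < d by rewrite (lt_trans _ d2).
have xC : 0 < 1 - x by rewrite subr_gt0.
have lnx : ln x < 0 by exact: ln_lt0.
have lnxC : ln (1 - x) < 0 by rewrite ln_lt0// xC ltrBlDr ltrDl.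
have -> : f x d d = (d / 2 - 1) * (x * ln x + (1 - x) * ln (1 - x)).
  have -> : f x d d = x * (d / 2 - 1) * ln x + (1 - x) * (d - 1) * ln (1 - x)
     + 1 / 2 * d * ln d - 1 / 2 * x * d * ln d
     - 1 / 2 * (d * (1 - x)) * ln (d * (1 - x)).
    rewrite /f subrr mulr0 mul0r subr0.
    by have -> : d - 2 * x * d + x * d = d * (1 - x) by ring.
  by rewrite lnM ?posrE//; field.
rewrite pmulr_rlt0.
  by rewrite -oppr_gt0 opprD -!mulrN addr_gt0// mulr_gt0// oppr_gt0.
by rewrite subr_gt0 ltr_pdivlMr// mul1r.
Qed.

Lemma f_zero_between x d y : 0 < x < 1 -> 2 < d -> y <= d -> 0 <= f x y d ->
  exists2 z, y <= z < d & f x z d = 0.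
Proof.
move=> x01 d2 yd fy; have fd := f_lt0_clique x01 d2.
have [||z] := @IVT R (fun y => f x y d) y d 0 yd.
- by apply: continuous_subspaceT; exact: continuous_f_y.
- by rewrite min_r ?max_l ?fy ?(ltW fd)//; exact: le_trans (ltW fd) fy.
rewrite in_itv/= => /andP[yz zd] fz; exists z => //; rewrite yz lt_neqAle zd andbT.
by apply: contraPneq fz => -> f0; rewrite f0 ltxx in fd.
Qed.

(** The side condition on y holds by itself above the mean density xd, since
    d - 2xd + x(xd) = d (1 - x)^2. *)
Lemma f_domain x d y : 0 < x < 1 -> 2 < d -> x * d <= y ->
  0 <= d - 2 * x * d + x * y.
Proof.
move=> /andP[x0 x1] d2 xdy.
have : 0 <= x * (y - x * d) by rewrite mulr_ge0 ?subr_ge0// ltW.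
have : 0 <= d * (1 - x) ^+ 2 by rewrite mulr_ge0 ?sqr_ge0//; lra.
by nra.
Qed.

(** The zeros in the interval [xd, d] form a compact set, nonempty by the signs of f
    at the two ends, and its maximum is also the largest of all zeros. *)
Lemma ybar_max x d : 0 < x < 1 -> 2 < d ->
  (zeros_f x d `&` ubound (zeros_f x d)) (ybar x d) /\ x * d <= ybar x d.
Proof.
move=> x01 d2; have /andP[x0 x1] := x01; have d0 : 0 < d by lra.
have xd : x * d <= d by rewrite ger_pMl// ltW.
have [z /andP[xz zd] fz] := f_zero_between x01 d2 xd (ltW (f_gt0_mean x01 d0)).
pose K := `[x * d, d] `&` [set y | f x y d = 0].
have cK : compact K.
  apply: compact_closedI; first exact: segment_compact.
  rewrite (_ : [set y | _] = (fun y => f x y d) @^-1` [set 0]) //.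
  by apply: preimage_closed; [move=> t _; exact: continuous_f_y|exact: closed_eq].
have [||c] := @compact_EVT_max R R idfun K _ cK.
- by exists z; split => //=; rewrite in_itv/= xz ltW.
- by apply: continuous_subspaceT => t; exact: cvg_id.
rewrite inE => -[/=]; rewrite in_itv/= => /andP[xc cd] fc cmax.
have {}cd : c < d.
  rewrite lt_neqAle cd andbT; apply: contraPneq fc => -> f0.
  by have := f_lt0_clique x01 d2; rewrite f0 ltxx.
have Pc : (zeros_f x d `&` ubound (zeros_f x d)) c.
  split; first split => //.
  - by rewrite cd andbT (lt_le_trans _ xc)// mulr_gt0.
  - exact: f_domain.
  move=> y [/andP[y0 yd] _ fy].
  have [xy|/ltW yx] := leP (x * d) y; last exact: le_trans xc.
  by apply: cmax; rewrite inE; split=> //=; rewrite in_itv/= xy ltW.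
have Py : (zeros_f x d `&` ubound (zeros_f x d)) (ybar x d).
  by rewrite /ybar; case: xgetP => [y _ //|/(_ c)].
by split => //; apply: le_trans xc _; case: Py => _; apply; case: Pc.
Qed.

Lemma f_lt0_above_ybar x d y : 0 < x < 1 -> 2 < d -> ybar x d < y -> y <= d ->
  f x y d < 0.
Proof.
move=> x01 d2 yb yd; have [[_ ub] xb] := ybar_max x01 d2.
rewrite ltNge; apply/negP => f0.
have [z /andP[yz zd] fz] := f_zero_between x01 d2 yd f0.
have xz : x * d <= z by rewrite (le_trans xb)// (le_trans (ltW yb)).
have : z <= ybar x d.
  apply: ub; split => //; last exact: f_domain.
  by rewrite zd andbT (lt_le_trans _ xz)// mulr_gt0//; lra.
by rewrite leNgt (lt_le_trans yb).
Qed.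

Lemma U3_ge x d : 0 < x < 1 -> 2 < d -> ybar x d / d - x <= U3 d.
Proof.
move=> x01 d2; apply: ub_le_sup; last by exists x.
exists 1 => _ [z /= z01 <-]; have [[[/andP[_ yd] _ _] _] _] := ybar_max z01 d2.
have : ybar z d / d <= 1 by rewrite ler_pdivrMr ?mul1r ?ltW//; lra.
by case/andP: z01 => *; lra.
Qed.

Lemma U3_ge0 d : 2 < d -> 0 <= U3 d.
Proof.
move=> d2; have h01 : 0 < (2^-1 : R) < 1 by lra.
apply: le_trans (U3_ge h01 d2); have [_ hb] := ybar_max h01 d2.
by rewrite subr_ge0 ler_pdivlMr//; lra.
Qed.

(** Compactness: the region is closed, and x stays away from 1 because y/d <= 1. *)
Lemma f_uniformly_lt0 d delta e : 2 < d -> 0 < delta -> 0 < e ->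
  exists2 eta, 0 < eta & forall x y, delta <= x -> y <= d ->
    U3 d + e <= y / d - x -> f x y d <= - eta.
Proof.
move=> d2 delta0 e0; have U0 := U3_ge0 d2; have d0 : 0 < d by lra.
have dI : 0 < d^-1 by rewrite invr_gt0.
pose K : set (R * R) := (`[delta, 1] `*` `[0, d]) `&` [set p | U3 d + e <= p.2 / d - p.1].
have yd1 y : y <= d -> y / d <= 1 by rewrite ler_pdivrMr// mul1r.
have inK x y : delta <= x -> y <= d -> U3 d + e <= y / d - x -> K (x, y).
  move=> dx yd xy; split => //=; rewrite !in_itv/= dx yd; split.
    by have := yd1 y yd; lra.
  have : 0 <= y / d by lra.
  by rewrite pmulr_lge0// => ->.
have fK x y : K (x, y) -> f x y d < 0.
  move=> [[/=]]; rewrite !in_itv/= => /andP[dx x1] /andP[y0 yd] xy.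
  have x01 : 0 < x < 1 by apply/andP; split; have := yd1 y yd; lra.
  apply: f_lt0_above_ybar => //; have := U3_ge x01 d2 => Ux.
  rewrite -(ltr_pM2r dI); lra.
have cK : compact K.
  apply: compact_closedI; first by apply: compact_setX; exact: segment_compact.
  rewrite (_ : [set p | _] =
    (fun p : R * R => p.2 / d - p.1) @^-1` [set t | U3 d + e <= t])//.
  apply: preimage_closed; last exact: closed_ge.
  move=> p _; apply: cvgB; last exact: cvg_fst.
  by apply: cvgMl; exact: cvg_snd.
have [K0|/set0P/negP/negPn/eqP K0] := pselect (K !=set0); last first.
  by exists 1 => // x y dx yd /(inK x y dx yd); rewrite K0.
have [|[x0 y0]] := @compact_EVT_max _ R (fun p : R * R => f p.1 p.2 d) K K0 cK.
  by apply: continuous_subspaceT; exact: continuous_f.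
rewrite inE => /= /fK f0 fmax; exists (- f x0 y0 d); first by rewrite oppr_gt0.
by move=> x y dx yd xy; rewrite opprK; apply: (fmax (x, y)); rewrite inE; exact: inK.
Qed.

End Exponent.

(** * Factorials and the exponent *)

Section Factorial.
Variable R : realType.
Local Notation h := (@xlnx R).

(** (z/e)^z, with the value 1 at z = 0. *)
Definition stirling (z : nat) : R := expR (h z%:R - z%:R).

Lemma stirling_gt0 z : 0 < stirling z. Proof. exact: expR_gt0. Qed.

Lemma lnS_sub (z : nat) : (0 < z)%N ->
  z%:R * (ln z.+1%:R - ln z%:R) <= 1 :> R /\ 1 <= z.+1%:R * (ln z.+1%:R - ln z%:R) :> R.
Proof.
move=> z0; have zR : 0 < z%:R :> R by rewrite ltr0n.
have z1R : 0 < z.+1%:R :> R by rewrite ltr0n.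
rewrite -ln_div ?posrE//; split.
  rewrite mulrC -ler_pdivlMr// mul1r.
  have -> : z.+1%:R / z%:R = 1 + z%:R^-1 :> R.
    by rewrite -natr1 mulrDl mul1r divff ?gt_eqF.
  by apply: le_ln1Dx; rewrite (lt_trans (ltrN10 _))// invr_gt0.
rewrite -ler_pdivrMl// mulr1 -[ln _]opprK -lnV ?posrE ?divr_gt0// invf_div lerNr.
have -> : z%:R / z.+1%:R = 1 + - z.+1%:R^-1 :> R.
  by rewrite -[z%:R](addrK 1) natr1 mulrBl mul1r divff ?gt_eqF.
by apply: le_ln1Dx; rewrite ltrN2 invf_lt1// ltr1n ltnS.
Qed.

Lemma stirling_le z : stirling z <= z`!%:R.
Proof.
elim: z => [|z IH]; first by rewrite /stirling /xlnx mul0r subr0 expR0 fact0.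
rewrite factS natrM; apply: le_trans (ler_wpM2l (ler0n _ _) IH).
rewrite -[X in _ <= X * _](@lnK R) ?posrE ?ltr0n// -expRD ler_expR /xlnx.
have [->|z0] := posnP z; first by rewrite ln1 !mul0r mulr0; lra.
have [H _] := lnS_sub z0; move: H; rewrite -!natr1; set a := ln _; set b := ln _.
lra.
Qed.

Lemma fact_le_stirling z : z`!%:R <= expR 1 * z.+1%:R * stirling z.
Proof.
have [->|z0] := posnP z.
  by rewrite fact0 /stirling /xlnx mul0r subr0 expR0 !mulr1 -[leLHS]expR0 ler_expR.
apply: (@le_trans _ _ (expR 1 * z%:R * stirling z)); last first.
  by rewrite ler_pM2r ?stirling_gt0// ler_pM2l ?expR_gt0// ler_nat.
elim: z z0 => // z IH _; have [->|z0] := posnP z.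
  by rewrite factS fact0 /stirling /xlnx ln1 mulr0 sub0r mulr1 -expRD subrr expR0.
rewrite factS natrM [expR 1 * _]mulrC -mulrA ler_pM2l ?ltr0n//.
apply: le_trans (IH z0) _; rewrite -mulrA ler_pM2l ?expR_gt0//.
rewrite -[X in X * _ <= _](@lnK R) ?posrE ?ltr0n// -expRD ler_expR /xlnx.
have [_ H] := lnS_sub z0; move: H; rewrite -!natr1; set a := ln _; set b := ln _.
lra.
Qed.

(** All logarithms of the scale n cancel, because the arguments of h on the left, taken
    with their signs, sum to zero; the logarithms of 2 come from the halves in the
    numbers of edges. *)
Lemma exponentE (n x y d : R) : 0 <= n -> 0 <= x <= 1 -> 0 <= y <= d ->
   0 <= d - 2 * x * d + x * y ->
  h n + h (d * (n * x)) + h (d * (n * (1 - x))) - h (n * x) - h (n * (1 - x))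
   - h (n * (2^-1 * d)) - h (n * (2^-1 * (x * y)))
   - h (n * (2^-1 * (d - 2 * x * d + x * y))) - h (n * (x * (d - y)))
   = n * (f x y d + (d - x * d + x * y) * ln 2).
Proof.
move=> n0 /andP[x0 x1] /andP[y0 yd] Q0.
have x1' : 0 <= 1 - x by rewrite subr_ge0.
have yd' : 0 <= d - y by rewrite subr_ge0.
have d0 : 0 <= d by exact: le_trans yd.
have h2 : 0 <= 2^-1 :> R by rewrite invr_ge0.
rewrite !xlnxM ?mulr_ge0// fE.
have -> : h 2^-1 = - (2^-1 * ln 2) by rewrite /xlnx lnV ?posrE// mulrN.
by field.
Qed.

End Factorial.

Section Types.
Variables (R : realType) (d n k l a b c M : nat).
Hypotheses (Hn : (k + l = n)%N) (Ha : (2 * a + c = d * k)%N)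
  (Hb : (2 * b + c = d * l)%N) (HM : (d * n = 2 * M)%N) (k0 : (0 < k)%N).
Local Notation h := (@xlnx R).
Local Notation st := (@stirling R).
Let x : R := k%:R / n%:R.
Let y : R := 2 * a%:R / k%:R.

(** Here k = #|S|, l = n - k, and M, a, b, c are the numbers of all edges and of those
    inside S, outside S and across; x and y are the relative size of S and its inner
    average degree. *)
Lemma stirling_split :
  st n * st (d * k) * st (d * l) =
  st k * st l * (st M * st a * st b * st c) * 2 ^+ (M + a + b)
    * expR (n%:R * f x y d%:R).
Proof.
have kR : 0 < k%:R :> R by rewrite ltr0n.
have nR : 0 < n%:R :> R by rewrite ltr0n; lia.
have lE : l%:R = n%:R - k%:R :> R by rewrite -Hn natrD; ring.
have cE : c%:R = d%:R * k%:R - 2 * a%:R :> R by rewrite -natrM -Ha natrD natrM; ring.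
have bE : b%:R = 2^-1 * (d%:R * l%:R - c%:R) :> R.
  by rewrite -natrM -Hb natrD natrM; field.
have ME : M%:R = n%:R * (2^-1 * d%:R) :> R.
  by rewrite mulrCA [_ * d%:R]mulrC -natrM HM natrM; field.
have kE : k%:R = n%:R * x by rewrite /x; field; rewrite gt_eqF.
have lE' : l%:R = n%:R * (1 - x) by rewrite lE kE; ring.
have aE : a%:R = n%:R * (2^-1 * (x * y)) by rewrite /x /y; field; rewrite !gt_eqF.
have cE' : c%:R = n%:R * (x * (d%:R - y)) by rewrite cE aE kE; field.
have bE' : b%:R = n%:R * (2^-1 * (d%:R - 2 * x * d%:R + x * y)).
  by rewrite bE cE' lE'; field.
have x01 : 0 <= x <= 1.
  by rewrite /x divr_ge0//= ler_pdivrMr// mul1r ler_nat -Hn leq_addr.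
have yd : 0 <= y <= d%:R.
  by rewrite /y divr_ge0//= ler_pdivrMr// -!natrM ler_nat -Ha leq_addr.
have Q0 : 0 <= d%:R - 2 * x * d%:R + x * y.
  by have : 0 <= b%:R :> R by []; rewrite bE' !pmulr_rge0// invr_gt0.
have := exponentE (ltW nR) x01 yd Q0.
rewrite -!kE -!lE' -ME -aE -bE' -cE' => H.
have E2 m : 2 ^+ m = expR (m%:R * ln 2) :> R by rewrite expRM_natl lnK// posrE.
rewrite E2 /stirling -!expRD; congr expR.
rewrite !natrM !natrD.
have -> : n%:R * f x y d%:R = h n%:R + h (d%:R * k%:R) + h (d%:R * l%:R) - h k%:R - h l%:R
  - h M%:R - h a%:R - h b%:R - h c%:R - n%:R * (d%:R - x * d%:R + x * y) * ln 2.
  by rewrite H; ring.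
have -> : n%:R * (d%:R - x * d%:R + x * y) = M%:R + a%:R + b%:R.
  by rewrite ME aE bE'; field.
rewrite lE cE bE lE cE.
have -> : M%:R = 2^-1 * (d%:R * n%:R) :> R by rewrite ME; ring.
by field.
Qed.

Lemma fact_split_le :
  (n`! * (d * k)`! * (d * l)`!)%:R <=
  (k`! * l`! * (M`! * a`! * b`! * c`!) * 2 ^ (M + a + b))%:R
   * (expR 3 * n.+1%:R * (d * n).+1%:R ^+ 2) * expR (n%:R * f x y d%:R).
Proof.
have st0 := @stirling_gt0 R.
rewrite !natrM.
apply: (@le_trans _ _ ((expR 1 * n.+1%:R * st n) * (expR 1 * (d * n).+1%:R * st (d * k))
   * (expR 1 * (d * n).+1%:R * st (d * l)))).
  have F m m' : (m <= m')%N -> m`!%:R <= expR 1 * m'.+1%:R * st m.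
    move=> mm; apply: le_trans (fact_le_stirling R m) _.
    by rewrite ler_pM2r// ler_pM2l ?expR_gt0// ler_nat ltnS.
  have Fk := F _ _ (leq_mul (leqnn d) (leq_addr l k)).
  have Fl := F _ _ (leq_mul (leqnn d) (leq_addl k l)).
  rewrite Hn in Fk Fl.
  by apply: ler_pM => //; apply: ler_pM => //; exact: F.
have -> : expR 3 = expR 1 * expR 1 * expR 1 :> R by rewrite -!expRD; congr expR; ring.
have E := stirling_split.
rewrite [leLHS](_ : _ = (st n * st (d * k) * st (d * l)) *
   (expR 1 * expR 1 * expR 1 * n.+1%:R * (d * n).+1%:R ^+ 2)); last by ring.
rewrite E.
set e := expR 1; set u := n.+1%:R; set v := (d * n).+1%:R; set z := expR (_ * _).
have c0 : 0 <= e * e * e * u * v ^+ 2 by rewrite !mulr_ge0// ?sqr_ge0// expR_ge0.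
rewrite [leRHS]mulrAC ler_wpM2r//.
rewrite ler_wpM2r ?expR_ge0//.
rewrite natrX ler_wpM2r ?exprn_ge0//.
have L m : 0 <= st m by exact: ltW.
by repeat (apply: ler_pM; rewrite ?mulr_ge0// ?stirling_le//).
Qed.

End Types.

Section Count.
Variables (R : realType) (T : finType) (d M s : nat).
Hypotheses (HM : (d * #|T| = 2 * M)%N) (Hs : (d * d.+1 = 2 * s)%N)
  (big : (2 * d.+1 * d + s < M)%N).

Definition regular_with_inside (S : {set T}) a : {set {set {set T}}} :=
  finset (fun E => regular_graph d E && (edges_inside E S == a)).
Local Notation regs := (finset (fun E : {set {set T}} => regular_graph d E)).
Local Notation n := #|T|.

(** The upper count divided by the lower count; the factor 'C(n, #|S|), for the choice
    of S, is what turns the exponent into f. *)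
Lemma card_regular_with_inside (S : {set T}) (a : nat) : (0 < #|S|)%N ->
  #|regular_with_inside S a|%:R * 'C(n, #|S|)%:R <=
  #|regs|%:R * (s`!%:R * n%:R ^+ (4 * s) * 2 ^+ s
     * (expR 3 * n.+1%:R * (d * n).+1%:R ^+ 2)
     * expR (n%:R * f (#|S|%:R / n%:R) (2 * a%:R / #|S|%:R) (d%:R : R))).
Proof.
move=> S0.
have [->|/finset.set0Pn[E]] := eqVneq (regular_with_inside S a) finset.set0.
  by rewrite cards0 mul0r !mulr_ge0// ?exprn_ge0// expR_ge0.
rewrite inE => /andP[rE /eqP aE].
have [b [c [tE Ha Hb]]] := regular_split rE aE.
have Hn : (#|S| + #|finset.setC S| = n)%N by rewrite finset.cardsC.
have H1 := card_regular_split Ha Hb.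
have H2 := card_regular_graphs_ge HM Hs big.
have H3 := fact_split_le R Hn Ha Hb HM S0.
move: H1 H2 H3; rewrite -/(regular_with_inside S a).
set k := #|S| in S0 Ha Hn *; set l := #|finset.setC S| in Hb Hn *.
set B := #|regular_with_inside S a|; set N := #|regs|.
set z := expR (_ * _); set X := expR 3 * _ * _.
move=> H1 H2.
have : (B * (2 ^ M * M`!) * (2 ^ a * a`! * (2 ^ b * b`!) * c`!) <=
     2 ^ s * s`! * n ^ (4 * s) * N * ((d * k)`! * (d * l)`!))%N.
  have D0 : (0 < d`! ^ n)%N by rewrite expn_gt0 fact_gt0.
  rewrite -(leq_pmul2r D0).
  have -> : (2 ^ M = 2 ^ s * 2 ^ (M - s))%N by rewrite -expnD subnKC//; lia.
  have := leq_mul (leqnn (2 ^ s)%N) (leq_mul H1 H2).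
  move: (2 ^ (M - s))%N (2 ^ s)%N (2 ^ a)%N (2 ^ b)%N (d`! ^ n)%N (n ^ (4 * s))%N.
  move: M`! a`! b`! c`! s`! ((d * k)`! * (d * l)`!)%N.
  by move=> m1 m2 m3 m4 m5 m6 m7 m8 m9 m10 m11 m12; rewrite -!mulnA; lia.
rewrite -(ler_nat R) => H3 H4.
set Den := (2 ^ M * M`! * (2 ^ a * a`! * (2 ^ b * b`!) * c`!))%N.
have Den0 : 0 < (k`! * l`! * Den)%:R :> R.
  by rewrite ltr0n /Den !muln_gt0 !expn_gt0 !fact_gt0.
rewrite -(ler_pM2r Den0).
have -> : B%:R * 'C(n, k)%:R * (k`! * l`! * Den)%:R = (B * Den * n`!)%:R :> R.
  rewrite -(bin_fact (_ : (k <= n)%N)); last by rewrite -Hn leq_addr.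
  have -> : (n - k = l)%N by rewrite -Hn addKn.
  by rewrite -!natrM; congr _%:R; lia.
apply: (@le_trans _ _
  ((2 ^ s * s`! * n ^ (4 * s) * N)%:R * (n`! * (d * k)`! * (d * l)`!)%:R)).
  rewrite -natrM ler_nat; move: H3; rewrite ler_nat -mulnA -/Den => H3.
  by have := leq_mul H3 (leqnn n`!); rewrite -!mulnA [((d * l)`! * n`!)%N]mulnC
    [((d * k)`! * (_ * _))%N]mulnCA.
apply: le_trans (ler_wpM2l (ler0n _ _) H4) _.
rewrite -(natrX R n (4 * s)); move: (n ^ (4 * s))%N => p.
rewrite /Den !expnD !natrM !natrX.
by rewrite le_eqVlt; apply/orP; left; apply/eqP; ring.
Qed.
End Count.

(** * The union bound *)

Section UnionBound.
Variable R : realType.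

(** Each of the #|T| + 1 possible sizes contributes 1. *)
Lemma sum_inv_bin (T : finType) :
  \sum_(S : {set T}) ('C(#|T|, #|S|)%:R)^-1 = #|T|.+1%:R :> R.
Proof.
have lt (S : {set T}) : (#|S| < #|T|.+1)%N by rewrite ltnS max_card.
rewrite (partition_big (fun S : {set T} => Ordinal (lt S)) predT)//=.
transitivity (\sum_(k < #|T|.+1) (1 : R)); last by rewrite sumr_const card_ord.
apply: eq_bigr => k _.
rewrite (eq_bigr (fun=> ('C(#|T|, k)%:R)^-1)) => [|S /eqP <-//].
rewrite sumr_const [X in _ *+ X](_ : _ = 'C(#|T|, k)); last first.
  by rewrite -card_draws; apply: eq_card => S; rewrite inE.
rewrite -[LHS]mulr_natl divff// pnatr_eq0 -lt0n bin_gt0 -ltnS//.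
Qed.

Lemma poly_mul_expN (p n : nat) (eta : R) : 0 < eta ->
  n.+1%:R ^+ p * expR (- (n%:R * eta)) <=
  (expR eta * (p.+1)`!%:R / eta ^+ p.+1) / n.+1%:R.
Proof.
move=> eta0; have n0 : 0 < n.+1%:R :> R by rewrite ltr0n.
have x0 : 0 <= eta * n.+1%:R by rewrite mulr_ge0// ltW.
have : (eta * n.+1%:R) ^+ p.+1 / (p.+1)`!%:R <= expR (eta * n.+1%:R).
  by apply: le_trans (expR_ge1Dxn p x0); rewrite lerDr.
have F0 : 0 < (p.+1)`!%:R :> R by rewrite ltr0n fact_gt0.
rewrite ler_pdivrMr// exprMn => H.
rewrite expRN ler_pdivlMr// mulrAC -exprSr ler_pdivlMr ?exprn_gt0//.
rewrite mulrAC ler_pdivrMr ?expR_gt0// mulrC.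
apply: le_trans H _; rewrite -natr1 mulrDr mulr1 expRD [eta * _]mulrC.
by rewrite le_eqVlt; apply/orP; left; apply/eqP; ring.
Qed.

Section Graphs.
Variables (T : finType) (d M s : nat).
Hypotheses (HM : (d * #|T| = 2 * M)%N) (Hs : (d * d.+1 = 2 * s)%N)
  (big : (2 * d.+1 * d + s < M)%N).
Local Notation n := #|T|.
Local Notation regs := (finset (fun E : {set {set T}} => regular_graph d E)).
Variables beta delta eta : R.
Hypotheses (beta0 : 0 <= beta) (delta0 : 0 < delta)
  (f_le : forall x y : R, delta <= x -> y <= d%:R -> beta <= y / d%:R - x ->
     f x y d%:R <= - eta).

Let Y : R := s`!%:R * n%:R ^+ (4 * s) * 2 ^+ s * (expR 3 * n.+1%:R * (d * n).+1%:R ^+ 2)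
     * expR (- (n%:R * eta)).

(** The negation of the hypothesis of [modularity_le] for the set S, when a is its
    number of inner edges. *)
Definition too_dense (S : {set T}) (a : nat) : bool :=
  (delta <= #|S|%:R / n%:R) && (#|S|%:R / n%:R * (beta + #|S|%:R / n%:R) < a%:R / M%:R).

Lemma card_too_dense S a : too_dense S a ->
  #|regular_with_inside d S a|%:R <= #|regs|%:R * Y * ('C(n, #|S|)%:R)^-1.
Proof.
move=> /andP[dS aS].
have M0 : 0 < M%:R :> R by rewrite ltr0n; lia.
have [n0 d0] : (0 < n)%N /\ (0 < d)%N.
  by split; rewrite lt0n; apply/eqP => z; move: HM big; rewrite z; lia.
have nR : 0 < n%:R :> R by rewrite ltr0n.
have dR : 0 < d%:R :> R by rewrite ltr0n.
have kR : 0 < #|S|%:R :> R.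
  by have := lt_le_trans delta0 dS; rewrite pmulr_lgt0 ?invr_gt0.
have k0 : (0 < #|S|)%N by rewrite -(ltr0n R).
have C0 : 0 < 'C(n, #|S|)%:R :> R by rewrite ltr0n bin_gt0 max_card.
have [->|/finset.set0Pn[E]] := eqVneq (regular_with_inside d S a) finset.set0.
  by rewrite cards0 !mulr_ge0// ?invr_ge0// ?exprn_ge0// expR_ge0.
rewrite inE => /andP[rE /eqP aE].
rewrite ler_pdivlMr//; apply: le_trans (card_regular_with_inside _ HM Hs big _ k0) _.
rewrite ler_wpM2l// /Y ler_wpM2l//.
rewrite ler_expR -mulrN ler_pM2l//.
apply: f_le => //.
  rewrite ler_pdivrMr// -!natrM ler_nat -aE; exact: edges_inside_le.
move: aS; rewrite -ltr_pdivlMl ?divr_gt0// => /ltW; rewrite -lerBrDr.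
move=> /le_trans; apply.
rewrite lerD2r le_eqVlt; apply/orP; left; apply/eqP.
have -> : M%:R = d%:R * n%:R / 2 :> R by rewrite -natrM HM natrM; field.
by field; rewrite !gt_eqF.
Qed.

Lemma card_modular_graphs :
  #|finset (fun E : {set {set T}} =>
      regular_graph d E && ~~ (modularity R E <= beta + 3 * delta))|%:R
   <= #|regs|%:R * (n.+1%:R * M.+1%:R * Y).
Proof.
have M0 : (0 < M)%N by lia.
have sub (E : {set {set T}}) :
    regular_graph d E && ~~ (modularity R E <= beta + 3 * delta) ->
    exists S, exists a : 'I_M.+1, too_dense S a && (E \in regular_with_inside d S a).
  move=> /andP[rE]; apply: contraNP => none; apply: (modularity_le rE HM M0) => // S dS.
  rewrite leNgt; apply/negP => lt; apply: none; exists S.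
  have aM : (edges_inside E S < M.+1)%N.
    rewrite ltnS -(regular_size HM rE); apply: subset_leq_card.
    by apply/fintype.subsetP => e; rewrite inE => /andP[].
  exists (Ordinal aM); rewrite /too_dense dS lt /= inE rE eqxx //.
have H1 : (#|finset (fun E : {set {set T}} =>
      regular_graph d E && ~~ (modularity R E <= beta + 3 * delta)%R)|
   <= \sum_(S : {set T}) \sum_(a < M.+1)
        (too_dense S a) * #|regular_with_inside d S a|)%N.
  rewrite -sum1_card big_mkcond /=.
  under [leqRHS]eq_bigr => S _ do
    under eq_bigr => a _ do rewrite -sum1_card big_mkcond big_distrr /=.
  under [leqRHS]eq_bigr => S _ do rewrite exchange_big /=.
  rewrite exchange_big /=; apply: leq_sum => E _; rewrite inE.
  case: ifP => // /sub[S [a /andP[dSa Ea]]].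
  by rewrite (bigD1 S)//= (bigD1 a)//= dSa Ea.
apply: (@le_trans _ _ (\sum_(S : {set T}) \sum_(a < M.+1)
    #|regs|%:R * Y * ('C(n, #|S|)%:R)^-1)).
  rewrite -(ler_nat R) in H1; apply: le_trans H1 _; rewrite natr_sum; apply: ler_sum => S _.
  rewrite natr_sum; apply: ler_sum => a _.
  case: (boolP (too_dense S a)) => dSa; last first.
    by rewrite mul0n !mulr_ge0// ?invr_ge0// ?exprn_ge0// expR_ge0.
  by rewrite mul1n card_too_dense.
rewrite (eq_bigr (fun S : {set T} =>
    M.+1%:R * (#|regs|%:R * Y) * ('C(n, #|S|)%:R)^-1)) => [|S _]; last first.
  by rewrite sumr_const card_ord -[LHS]mulr_natl mulrA.
rewrite -mulr_sumr sum_inv_bin.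
by rewrite le_eqVlt; apply/orP; left; apply/eqP; ring.
Qed.

End Graphs.
End UnionBound.

Local Open Scope classical_set_scope.

Lemma counting_prob_compl (R : realType) (T : finType) (S : {set T}) (Q : pred T) :
  (0 < #|S|)%N -> 1 - counting_prob R S Q = counting_prob R S (predC Q).
Proof.
move=> S0; have SR : #|S|%:R != 0 :> R by rewrite pnatr_eq0 -lt0n.
rewrite /counting_prob -[X in X - _](divff SR) -mulrBl; congr (_ / _).
apply/eqP; rewrite subr_eq -natrD eqr_nat addnC; apply/eqP.
rewrite -(cardsID (finset Q) S); congr (_ + _)%N; apply: eq_card => x; rewrite !inE//.
by rewrite andbC.
Qed.

(** The polynomial factor has degree p = 4s + 5 in n: 4s from the completion to regular
    graphs, 3 from the three factorials in the numerator, 2 from the numbers of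
    choices of #|S| and a. *)
Lemma failure_bound (R : realType) (d s : nat) (beta delta eta : R) :
  (3 <= d)%N -> (d * d.+1 = 2 * s)%N -> 0 <= beta -> 0 < delta -> 0 < eta ->
  (forall x y : R, delta <= x -> y <= d%:R -> beta <= y / d%:R - x ->
     f x y d%:R <= - eta) ->
  exists C : R, forall n, (2 * d.+1 * d + s < n)%N -> ~~ odd (d * n) ->
    (0 < #|regular_graphs n d|)%N /\
    counting_prob R (regular_graphs n d)
      (fun E => ~~ (modularity R E <= beta + 3 * delta)) <= C / n.+1%:R.
Proof.
move=> d3 Hs beta0 delta0 eta0 f_le; pose p := (4 * s + 5)%N.
exists (s`!%:R * 2 ^+ s * expR 3 * d.+1%:R ^+ 3
  * (expR eta * (p.+1)`!%:R / eta ^+ p.+1)).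
move=> n nbig even_dn; pose M := (d * n)./2.
have HM : (d * #|'I_n| = 2 * M)%N.
  by rewrite card_ord /M mul2n -[LHS]odd_double_half (negPf even_dn).
have big : (2 * d.+1 * d + s < M)%N.
  apply: leq_trans nbig _; rewrite -(leq_pmul2l (isT : 0 < 2)%N) -HM card_ord.
  by rewrite leq_mul2r; apply/orP; right; exact: ltnW.
have N0 : (0 < #|regular_graphs n d|)%N.
  have := card_regular_graphs_ge HM Hs big.
  rewrite -/(regular_graphs n d); case: #|regular_graphs n d| => //.
  by rewrite !muln0 leqn0 muln_eq0 expn_eq0 /= -leqn0 leqNgt fact_gt0.
split=> //.
have := card_modular_graphs HM Hs big beta0 delta0 f_le.
rewrite -/(regular_graphs n d).
have -> : #|finset (fun E : {set {set 'I_n}} =>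
      regular_graph d E && ~~ (modularity R E <= beta + 3 * delta))|
  = #|finset (fun E => (E \in regular_graphs n d)
      && ~~ (modularity R E <= beta + 3 * delta))|.
  by apply: eq_card => E; rewrite !inE.
rewrite /counting_prob => H.
rewrite ler_pdivrMr ?ltr0n// [leRHS]mulrC; apply: le_trans H _; rewrite ler_wpM2l//.
rewrite !card_ord -mulrA.
have nR : 0 < n.+1%:R :> R by rewrite ltr0n.
have Mn : M.+1%:R <= d.+1%:R * n.+1%:R :> R.
  rewrite -natrM ler_nat mulSn mulnS; move: HM; rewrite card_ord; lia.
have dnn : (d * n).+1%:R <= d.+1%:R * n.+1%:R :> R by rewrite -natrM ler_nat; lia.
have nn : n%:R ^+ (4 * s) <= n.+1%:R ^+ (4 * s) :> R by rewrite lerXn2r ?nnegrE// ler_nat.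
apply: (@le_trans _ _ (n.+1%:R * (d.+1%:R * n.+1%:R)
  * (s`!%:R * n.+1%:R ^+ (4 * s) * 2 ^+ s *
   (expR 3 * n.+1%:R * (d.+1%:R * n.+1%:R) ^+ 2) * expR (- (n%:R * eta))))).
  rewrite mulrA; apply: ler_pM => //; rewrite ?mulr_ge0 ?exprn_ge0 ?expR_ge0 ?invr_ge0//.
    by rewrite ler_wpM2l.
  rewrite ler_wpM2r ?expR_ge0//.
  apply: ler_pM => //; rewrite ?mulr_ge0 ?exprn_ge0 ?expR_ge0//.
    by rewrite ler_wpM2r ?exprn_ge0// ler_wpM2l.
  by rewrite ler_wpM2l ?mulr_ge0 ?expR_ge0// lerXn2r ?nnegrE ?mulr_ge0.
have := poly_mul_expN p n eta0; set q := expR (- _); set c := expR eta * _ / _ => H.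
rewrite [leLHS](_ : _ =
  s`!%:R * 2 ^+ s * expR 3 * d.+1%:R ^+ 3 * (n.+1%:R ^+ p * q)); last first.
  by rewrite /p exprD; ring.
by rewrite -[leRHS]mulrA ler_wpM2l// !mulr_ge0 ?exprn_ge0 ?expR_ge0.
Qed.

Theorem theorem2 (R : realType) (d : nat) (eps : R) :
  (3 <= d)%N -> 0 < eps ->
  aas_regular R d
    (fun n (G : {set {set 'I_n}}) => modularity R G <= U3 (d%:R : R) + eps / d%:R).
Proof.
move=> d3 eps0.
have d2 : 2 < d%:R :> R by rewrite ltr_nat.
pose e := eps / d%:R; have e0 : 0 < e by rewrite divr_gt0// (lt_trans _ d2).
have delta0 : 0 < e / 6 by rewrite divr_gt0.
have half0 : 0 < e / 2 by rewrite divr_gt0.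
have [eta eta0 f_le] := f_uniformly_lt0 d2 delta0 half0.
have Hs : (d * d.+1 = 2 * (d * d.+1)./2)%N.
  by rewrite mul2n -[LHS]odd_double_half oddM /= andbN.
have beta0 : 0 <= U3 d%:R + e / 2 by rewrite addr_ge0 ?U3_ge0 ?ltW.
have [C HC] := failure_bound d3 Hs beta0 delta0 eta0 f_le.
have eE : U3 d%:R + e / 2 + 3 * (e / 6) = U3 d%:R + eps / d%:R.
  by rewrite -/e; field.
rewrite eE in HC.
have C0 : C / n.+1%:R @[n --> \oo] --> (0 : R).
  by rewrite -[X in _ --> X](mulr0 C); apply: cvgMr; exact: cvg_harmonic.
apply/cvgrPdist_le => r r0.
move/cvgrPdist_le : C0 => /(_ r r0) Cr.
have n_large : \forall n \near \oo, (2 * d.+1 * d + (d * d.+1)./2 < n)%N.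
  by exists (2 * d.+1 * d + (d * d.+1)./2).+1.
change (\oo [set n | (odd d -> ~~ odd n) -> `|1 - counting_prob R (regular_graphs n d)
  (fun G => modularity R G <= U3 (d%:R : R) + eps / d%:R)| <= r]).
apply: filterS (filterI Cr n_large) => n [+ nbig] adm.
rewrite sub0r normrN => Cn.
have even_dn : ~~ odd (d * n) by rewrite oddM negb_and -implybE; apply/implyP.
have [N0 Hn] := HC n nbig even_dn.
rewrite counting_prob_compl// ger0_norm ?divr_ge0//.
by apply: le_trans Hn _; exact: le_trans (ler_norm _) Cn.
Qed.
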